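(* For every $\mu_0\in(0,1/2]$ there exists a positive constant $C(\mu_0)$, depending only on $\mu_0$, such that the following holds. Let $S$ be the SRRW on a finite group $G$ ($|G|\ge2$) with reinforcement parameter $\alpha\in[0,1)$ and step distribution $\mu$ such that $\mu(e_G)\ge\mu_0$. Then, for any $\varepsilon\in(0,1)$, $$t^{(\alpha)}_\infty(\varepsilon)\le\frac{C(\mu_0)}{1-\alpha}\int_{4/|G|}^{8/\varepsilon}\frac1{u\,\Phi^2(u)}\,du,$$ where $t^{(\alpha)}_\infty(\varepsilon)$ is the $\varepsilon$-uniform mixing time and $\Phi$ is the isoperimetric profile of $P_\mu$.
   Context: SRRW: Let $(G,\cdot)$ be a discrete group with $|G|\ge2$ and identity $e_G$, $\mu$ a probability measure on $G$, and $\alpha\in[0,1)$. Let $(\xi_n)_{n\ge2}$ be i.i.d. Bernoulli random variables with $\mathbb{P}(\xi_n=1)=\alpha$, and let $(u_n)_{n\ge2}$ be independent with $u_n$ uniform on $\{1,\dots,n-1\}$; these two sequences and all fresh samples from $\mu$ below are independent. Set $S_0=e_G$; sample $X_1$ from $\mu$ and set $S_1=X_1$. For $n>1$: if $\xi_n=1$ set $X_n=X_{u_n}$; if $\xi_n=0$ sample $X_n$ afresh from $\mu$; put $S_n=S_{n-1}\cdot X_n$. The process $(S_n)$ is the SRRW on $G$ (started at $e_G$) with step distribution $\mu$ and reinforcement parameter $\alpha$. Uniform mixing time: $d_\infty(n)=\max_{x\in G}\big|\,|G|\cdot\mathbb{P}(S_n=x)-1\big|$ and $t^{(\alpha)}_\infty(\varepsilon)=\inf\{n\ge1:\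 d_\infty(m)\le\varepsilon\ \text{ for all } m\ge n\}$ (with $\inf\emptyset=\infty$). Isoperimetric profile: $P_\mu(x,y)=\mu(x^{-1}\cdot y)$; $P_\mu(A,B)=\sum_{x\in A,\,y\in B}P_\mu(x,y)$ for $A,B\subset G$; for nonempty $A\subset G$, $\Phi(A)=P_\mu(A,A^c)/|A|$ and $U(A)=|A|/|G|$. Then $\Phi(r)=\inf\{\Phi(A):A\ne\emptyset,\ U(A)\le r\}$ for $r\in[1/|G|,1/2]$ and $\Phi(r)=\Phi(1/2)$ for $r>1/2$. If $\Phi(1/2)=0$, the integral is understood as $+\infty$. *)

(* Defs.v *)
From HB Require Import structures.
From mathcomp Require Import all_boot all_order all_algebra all_fingroup.
From mathcomp Require Import all_classical all_reals all_analysis.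

Set Implicit Arguments.
Unset Strict Implicit.
Unset Printing Implicit Defensive.

Import Order.TTheory GRing.Theory Num.Theory.

Local Open Scope classical_set_scope.
Local Open Scope ring_scope.

Section Independence.
Context {R : realType} {d : measure_display} {T : measurableType d}.

(* Random variables with values in a countable type E carrying the discrete
   sigma-algebra (all subsets of E). *)
Definition discrete_rv {E : Type} (X : T -> E) : Prop :=
  forall B : set E, measurable (X @^-1` B).

Definition sigma_discrete {E : Type} (X : T -> E) : set (set T) :=
  [set X @^-1` B | B in [set: set E]].

Definition mutually_independent (P : probability T R) (I : eqType)
    (F : I -> set (set T)) : Prop :=
  forall (J : seq I) (A : I -> set T), uniq J ->
    (forall i, i \in J -> F i (A i)) ->
    P (\bigcap_(i in [set` J]) A i) = (\prod_(i <- J) P (A i))%E.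

End Independence.

Definition is_pmf {R : realType} {gT : finType} (mu : gT -> R) : Prop :=
  (forall x, 0 <= mu x) /\ \sum_(x : gT) mu x = 1.

Section SRRW.
Context {R : realType} {d : measure_display} {T : measurableType d}.
Context (P : probability T R) {gT : finGroupType}.
Context (mu : gT -> R) (alpha : R).

(* The sources of randomness are xi_n and u_n for n >= 2 and the fresh samples
   Y_n for n >= 1; the shifts of the index discard the unused variables. *)
Definition srrw_sources (xi : nat -> T -> bool) (u : nat -> T -> nat)
    (Y : nat -> T -> gT) (i : nat + (nat + nat)) : set (set T) :=
  match i with
  | inl n => sigma_discrete (xi n.+2)
  | inr (inl n) => sigma_discrete (u n.+2)
  | inr (inr n) => sigma_discrete (Y n.+1)
  end.

Record srrw_construction (xi : nat -> T -> bool) (u : nat -> T -> nat)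
    (Y X S : nat -> T -> gT) : Prop := {
  srrw_xi_rv : forall n, (2 <= n)%N -> discrete_rv (xi n);
  srrw_u_rv : forall n, (2 <= n)%N -> discrete_rv (u n);
  srrw_Y_rv : forall n, (1 <= n)%N -> discrete_rv (Y n);
  srrw_xi_law : forall n, (2 <= n)%N ->
    P (xi n @^-1` [set true]) = alpha%:E;
  srrw_u_range : forall n w, (2 <= n)%N -> (1 <= u n w <= n.-1)%N;
  srrw_u_law : forall n k, (2 <= n)%N -> (1 <= k <= n.-1)%N ->
    P (u n @^-1` [set k]) = (n.-1%:R^-1)%:E;
  srrw_Y_law : forall n x, (1 <= n)%N -> P (Y n @^-1` [set x]) = (mu x)%:E;
  srrw_indep : mutually_independent P (srrw_sources xi u Y);
  srrw_X1 : forall w, X 1%N w = Y 1%N w;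
  srrw_XS : forall n w, (2 <= n)%N ->
    X n w = if xi n w then X (u n w) w else Y n w;
  srrw_S0 : forall w, S 0%N w = 1%g;
  srrw_SS : forall n w, (1 <= n)%N -> S n w = (S n.-1 w * X n w)%g
}.

Definition is_SRRW (S : nat -> T -> gT) : Prop :=
  exists xi u Y X, srrw_construction xi u Y X S.

End SRRW.

Section UniformMixing.
Context {R : realType} {d : measure_display} {T : measurableType d}.
Context (P : probability T R) {gT : finGroupType}.
Context (S : nat -> T -> gT).

Definition d_infty (n : nat) : R :=
  \big[Num.max/0]_(x : gT) `| #|gT|%:R * fine (P (S n @^-1` [set x])) - 1 |.

Definition uniform_mixing_time (eps : R) : \bar R :=
  ereal_inf [set n%:R%:E | n in
    [set n : nat | (1 <= n)%N /\
                   forall m : nat, (n <= m)%N -> d_infty m <= eps]].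

End UniformMixing.

Section IsoperimetricProfile.
Context {R : realType} {gT : finGroupType}.
Context (mu : gT -> R).

Definition trans_prob (x y : gT) : R := mu (x^-1 * y)%g.

Definition trans_flow (A B : {set gT}) : R :=
  \sum_(x in A) \sum_(y in B) trans_prob x y.

Definition bottleneck (A : {set gT}) : R := trans_flow A (~: A)%SET / #|A|%:R.

Definition profile_below (r : R) : R :=
  inf [set bottleneck A | A in
    [set A : {set gT} | (0 < #|A|)%N /\ #|A|%:R / #|gT|%:R <= r]].

(* Only meaningful for r >= 1/#|gT|, where the infimum is over a nonempty
   family. *)
Definition isoperimetric_profile (r : R) : R :=
  if r <= 2^-1 then profile_below r else profile_below 2^-1.

Definition profile_integral (a b : R) : \bar R :=
  if isoperimetric_profile 2^-1 == 0 then +oo%E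
  else (\int[lebesgue_measure]_(u in `[a, b])
          ((u * isoperimetric_profile u ^+ 2)^-1)%:E)%E.

End IsoperimetricProfile.

(* Main.v *)
Require Import Defs.
From HB Require Import structures.
From mathcomp Require Import all_boot all_order all_algebra all_fingroup.
From mathcomp Require Import all_classical all_reals all_analysis.
From mathcomp Require Import measurable_realfun ring lra zify.

(** Let [I] be the profile integral. A step of the walk is either fresh or a
    copy of an earlier step, so the position at time [n] is a product of
    independent samples of [mu] read along a random word, in which a letter
    may occur several times. Conditionally on the word and on the samples
    whose letter occurs at least twice, the position is a time-inhomogeneous
    walk: at the places of the letters occurring once it makes a fresh step of
    law [mu], elsewhere it is multiplied by a prescribed element.

    Multiplication by a prescribed element is a permutation of the group, so
    it preserves the chi-square distance [chi2] to the uniform law. A fresh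
    step multiplies it by at most [1 - (mu0 / 16) Phi (4 / chi2) ^ 2]
    ([convolve_chi2]): since [mu] charges the identity, the loss of variance
    is at least a multiple of the Dirichlet form ([convolve_dirichlet]), which
    is bounded below through a Cheeger inequality applied to a truncation of
    the density, whose level sets are small when [chi2] is large ([cheeger],
    [dirichlet_chi2]). Comparing this recursion with the integral, in the
    variable [u = 4 / chi2], shows that about [16 I / mu0] fresh steps bring
    [chi2] below [eps / 2], whatever the prescribed elements are
    ([walk_mixes]). Cutting the walk in two halves and reversing the second
    one turns this into a uniform bound ([walk_uniform]); the reversed step
    law has the same profile.

    It remains to see that the word of length [n] has a number of single
    letters at least of order [(1 - alpha) n]. A fresh step creates one, of
    probability [1 - alpha], and a copy destroys one with probability the
    current proportion of single letters; following the Laplace transform of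
    their number with a time-dependent parameter gives an exponential
    lower-tail bound ([few_singles]). The probability of the exceptional words
    has to beat the trivial bound [N] on the distance, where [N] is the order
    of the group; this needs [(1 - alpha) n] to dominate [ln (2 N / eps)],
    which the integral does because the profile is at most 1
    ([profile_tail_doubling]). *)

Set Implicit Arguments.
Unset Strict Implicit.
Unset Printing Implicit Defensive.

Import Order.TTheory GRing.Theory Num.Theory.

Local Open Scope ring_scope.

(** * Dirichlet form and Cheeger inequality of the reference walk *)

Section DirichletForm.
Context {R : realType} {gT : finGroupType} (mu : gT -> R).
Context (mu_pmf : is_pmf mu).

Local Notation p := (trans_prob mu).

Lemma trans_prob_ge0 x y : 0 <= p x y.
Proof. exact: mu_pmf.1. Qed.

Lemma trans_prob_row x : \sum_y p x y = 1.
Proof.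
rewrite -mu_pmf.2 (reindex_inj (mulgI x)) /=.
by apply: eq_bigr => g _; rewrite /trans_prob mulKg.
Qed.

Lemma trans_prob_col y : \sum_x p x y = 1.
Proof.
rewrite -mu_pmf.2 (reindex (fun g => y * g^-1)%g) /=; last first.
  exists (fun x => x^-1 * y)%g => z _; first by rewrite invMg invgK mulgKV.
  by rewrite invMg invgK mulKVg.
by apply: eq_bigr => g _; rewrite /trans_prob invMg invgK mulgKV.
Qed.

Lemma trans_flow_ge0 A B : 0 <= trans_flow mu A B.
Proof. by do 2![apply: sumr_ge0 => ? _]; exact: trans_prob_ge0. Qed.

(** The uniform distribution is stationary, so the flows out of and into a set
    balance: rows and columns of the transition matrix both sum to one. *)
Lemma trans_flow_setC (A : {set gT}) :
  trans_flow mu (~: A) A = trans_flow mu A (~: A).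
Proof.
have H1 : trans_flow mu A (~: A) + trans_flow mu A A = #|A|%:R.
  rewrite -big_split /= -sum1_card natr_sum; apply: eq_bigr => x _.
  rewrite -(trans_prob_row x) addrC [RHS](bigID (mem A)) /=.
  by congr (_ + _); apply: eq_bigl => y; rewrite inE.
have H2 : trans_flow mu (~: A) A + trans_flow mu A A = #|A|%:R.
  rewrite /trans_flow exchange_big /= [X in _ + X]exchange_big /= -big_split /=.
  rewrite -sum1_card natr_sum; apply: eq_bigr => x _.
  rewrite -(trans_prob_col x) addrC [RHS](bigID (mem A)) /=.
  by congr (_ + _); apply: eq_bigl => y; rewrite inE.
by apply: (addIr (trans_flow mu A A)); rewrite H1 H2.
Qed.

Definition dirichlet (f : gT -> R) : R :=
  \sum_x \sum_y p x y * (f x - f y) ^+ 2.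

Lemma dirichlet_contraction (f h : gT -> R) :
  (forall x y, (f x - f y) ^+ 2 <= (h x - h y) ^+ 2) ->
  dirichlet f <= dirichlet h.
Proof.
move=> fh; do 2![apply: ler_sum => ? _].
by apply: ler_wpM2l (fh _ _); exact: trans_prob_ge0.
Qed.

(** Layer-cake argument. If [m] is the least positive value of [f] and [A] its
    support, replacing [f] by [f - m] on [A] lowers the left-hand side by
    [k * m * #|A|] and the right-hand side by [m] times the flow out of [A],
    and it shrinks the support; hence the induction on the size of the
    support. *)
Lemma coarea (k : R) (f : gT -> R) : 0 <= k ->
  (forall x, 0 <= f x) ->
  (forall A : {set gT}, (0 < #|A|)%N -> {in A, forall x, 0 < f x} ->
     k * #|A|%:R <= trans_flow mu A (~: A)) ->
  k * (\sum_x f x) <= \sum_x \sum_y p x y * Num.max (f x - f y) 0.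
Proof.
move=> k0; have [n] := ubnP #|[set x | 0 < f x]|.
elim: n f => // n IHn f; rewrite ltnS => fn f0 iso.
set A := [set x | 0 < f x] in fn.
have fA x : x \notin A -> f x = 0.
  by rewrite inE -leNgt => fx; apply/eqP; rewrite eq_le fx f0.
have [A0|[a aA]] := set_0Vmem A.
  rewrite big1 ?mulr0; last by move=> x _; rewrite fA // A0 inE.
  do 2![apply: sumr_ge0 => ? _]; rewrite mulr_ge0 ?trans_prob_ge0 //.
  by rewrite le_max lexx orbT.
have [b bA' bmin] := arg_minP f aA.
have {bA'} bA : b \in A by exact: bA'.
have [m0 fb] : 0 < f b /\ {in A, forall x, f b <= f x}.
  by split=> [|x xA]; [move: bA; rewrite inE | exact: bmin].
pose f' x := f x - f b * (x \in A)%:R.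
have f'0 x : 0 <= f' x.
  rewrite /f'; case: (boolP (x \in A)) => xA; first by rewrite mulr1 subr_ge0 fb.
  by rewrite mulr0 subr0.
have f'A x : 0 < f' x -> x \in A.
  rewrite /f'; case: (boolP (x \in A)) => // xA.
  by rewrite fA // mulr0 subr0 ltxx.
have f's : (#|[set x | 0 < f' x]%R| < n)%N.
  apply: leq_trans fn; apply: proper_card; apply/properP; split.
    by apply/fintype.subsetP => x; rewrite inE => /f'A.
  by exists b => //; rewrite inE /f' bA mulr1 subrr ltxx.
have {}IHn : k * (\sum_x f' x) <= \sum_x \sum_y p x y * Num.max (f' x - f' y) 0.
  apply: IHn => // B B0 Bf; apply: iso => // x xB.
  by have := f'A _ (Bf _ xB); rewrite inE.
have isoA : k * #|A|%:R <= trans_flow mu A (~: A).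
  by apply: iso => [|x]; [apply/card_gt0P; exists a | rewrite inE].
have -> : \sum_x f x = \sum_x f' x + f b * #|A|%:R.
  rewrite -sum1_card natr_sum mulr_sumr [X in _ + X]big_mkcond /= -big_split /=.
  apply: eq_bigr => x _; rewrite /f'.
  by case: (x \in A); rewrite ?mulr0 ?subr0 ?addr0 // subrK.
rewrite mulrDr mulrCA.
apply: (@le_trans _ _ (\sum_x \sum_y p x y * Num.max (f' x - f' y) 0
                       + f b * trans_flow mu A (~: A))).
  by apply: lerD => //; rewrite ler_pM2l.
rewrite /trans_flow mulr_sumr [X in _ + X]big_mkcond /= -big_split /=.
apply: ler_sum => x _; case: (boolP (x \in A)) => xA; last first.
  rewrite addr0; apply: ler_sum => y _; apply: (ler_wpM2l (trans_prob_ge0 _ _)).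
  rewrite {1}/f' (negbTE xA) (fA x xA) mulr0 subr0 !sub0r.
  rewrite max_r ?oppr_le0 //; by rewrite le_max lexx orbT.
rewrite mulr_sumr [X in _ + X]big_mkcond /= -big_split /=.
apply: ler_sum => y _; rewrite inE /f' xA mulr1.
case: (boolP (y \in A)) => yA /=.
  by rewrite mulr1 addr0 opprB addrA subrK.
rewrite (fA y yA) !mulr0 !subr0 max_l ?subr_ge0 ?fb // max_l //.
by rewrite mulrBr [f b * _]mulrC subrK.
Qed.

(** Cheeger inequality for functions whose level sets are all subject to the
    isoperimetric bound [k]: apply the co-area inequality to [f ^+ 2] and
    split the increments of [f ^+ 2] as products, by Cauchy-Schwarz. The
    latter is used pointwise, in the form
    [k * (a^2 - b^2) <= 2 (a - b)^2 + k^2 (a + b)^2 / 8], so that no square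
    root is needed. *)
Lemma cheeger (k : R) (f : gT -> R) : 0 <= k ->
  (forall x, 0 <= f x) ->
  (forall A : {set gT}, (0 < #|A|)%N -> {in A, forall x, 0 < f x} ->
     k * #|A|%:R <= trans_flow mu A (~: A)) ->
  k ^+ 2 * (\sum_x f x ^+ 2) <= 4 * dirichlet f.
Proof.
move=> k0 f0 iso.
have co : k * (\sum_x f x ^+ 2)
    <= \sum_x \sum_y p x y * Num.max (f x ^+ 2 - f y ^+ 2) 0.
  apply: coarea => // [x|A A0 Af]; first exact: sqr_ge0.
  apply: iso => // x xA; have := Af x xA.
  by rewrite exprn_even_gt0 //= lt0r f0 => ->.
have sq : \sum_x \sum_y p x y * (f x ^+ 2 + f y ^+ 2) = 2 * \sum_x f x ^+ 2.
  transitivity (\sum_x \sum_y p x y * f x ^+ 2 + \sum_x \sum_y p x y * f y ^+ 2).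
    rewrite -big_split; apply: eq_bigr => x _; rewrite -big_split.
    by apply: eq_bigr => y _; rewrite /= mulrDr.
  rewrite mulr_natl mulr2n; congr (_ + _).
    by apply: eq_bigr => x _; rewrite -mulr_suml trans_prob_row mul1r.
  rewrite exchange_big /=.
  by apply: eq_bigr => x _; rewrite -mulr_suml trans_prob_col mul1r.
set F := \sum_x f x ^+ 2 in co sq *.
have : k * (k * F) <= 2 * dirichlet f + k ^+ 2 / 4 * (2 * F).
  apply: le_trans (ler_wpM2l k0 co) _.
  rewrite -sq /dirichlet !mulr_sumr -big_split /=; apply: ler_sum => x _.
  rewrite !mulr_sumr -big_split /=; apply: ler_sum => y _.
  have := trans_prob_ge0 x y; move: (p x y) => q q0.
  rewrite mulrCA [2 * _]mulrCA [_ / 4 * _]mulrCA -mulrDr.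
  apply: ler_wpM2l => //; have := f0 x; have := f0 y.
  move: (f x) (f y) => a b b0 a0.
  have sq0 := sqr_ge0 (2 * (a - b) - k * (a + b) / 2).
  have sq1 := sqr_ge0 (k * (a - b)).
  rewrite /Num.max; case: ifP => _; last by lra.
  have := mulr_ge0 (sqr_ge0 k) (addr_ge0 (sqr_ge0 a) (sqr_ge0 b)).
  by have := sqr_ge0 (a - b); lra.
by rewrite expr2; lra.
Qed.

End DirichletForm.

(** * The isoperimetric profile and the chi-square distance *)

Section Profile.
Context {R : realType} {gT : finGroupType} (mu : gT -> R).
Context (mu_pmf : is_pmf mu).

Local Notation N := (#|gT|%:R : R).

Lemma card_gT_gt0 : 0 < N.
Proof. by rewrite ltr0n; apply/card_gt0P; exists 1%g. Qed.

Lemma bottleneck_ge0 A : 0 <= bottleneck mu A.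
Proof. by rewrite divr_ge0 ?trans_flow_ge0. Qed.

Local Lemma profile_lbound r :
  has_lbound [set bottleneck mu A | A in
    [set A : {set gT} | (0 < #|A|)%N /\ #|A|%:R / N <= r]]%classic.
Proof. by exists 0 => _ [A _ <-]; exact: bottleneck_ge0. Qed.

Local Lemma profile_nonempty r : N^-1 <= r ->
  ([set bottleneck mu A | A in
    [set A : {set gT} | (0 < #|A|)%N /\ #|A|%:R / N <= r]] !=set0)%classic.
Proof.
move=> Nr; exists (bottleneck mu [set 1%g]).
by exists [set 1%g] => //=; rewrite cards1 mul1r.
Qed.

Lemma profile_below_anti r s : N^-1 <= r -> r <= s ->
  profile_below mu s <= profile_below mu r.
Proof.
move=> Nr rs; apply: lb_le_inf; first exact: profile_nonempty.
move=> _ [A [A0 Ar] <-]; apply: ge_inf; first exact: profile_lbound.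
by exists A => //; split=> //; exact: le_trans rs.
Qed.

Lemma profile_below_ge0 r : 0 <= profile_below mu r.
Proof.
rewrite /profile_below; set E := (X in inf X).
have [->|/set0P E0] := eqVneq E set0; first by rewrite inf0.
by apply: lb_le_inf => // _ [A _ <-]; exact: bottleneck_ge0.
Qed.

Lemma isoperimetric_profile_ge0 r : 0 <= isoperimetric_profile mu r.
Proof.
by rewrite /isoperimetric_profile; case: ifP => _; exact: profile_below_ge0.
Qed.

Lemma isoperimetric_profile_anti r s : N^-1 <= r -> r <= s ->
  isoperimetric_profile mu s <= isoperimetric_profile mu r.
Proof.
move=> Nr rs; rewrite /isoperimetric_profile.
case: (lerP s) => s2; case: (lerP r) => r2 //; first exact: profile_below_anti.
- by have := le_lt_trans (le_trans rs s2) r2; rewrite ltxx.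
- exact: profile_below_anti.
Qed.

Lemma isoperimetric_profile_le r (A : {set gT}) :
  (0 < #|A|)%N -> #|A|%:R / N <= r -> #|A|%:R / N <= 2^-1 ->
  isoperimetric_profile mu r * #|A|%:R <= trans_flow mu A (~: A).
Proof.
move=> A0 Ar A2; rewrite -ler_pdivlMr ?ltr0n //.
by rewrite /isoperimetric_profile; case: ifP => _; apply: ge_inf;
  [exact: profile_lbound|exists A|exact: profile_lbound|exists A].
Qed.

(** The chi-square distance to the uniform distribution of the distribution
    with mass function [f]: the variance of the density [N * f]. *)
Definition chi2 (f : gT -> R) : R := N * (\sum_x f x ^+ 2) - 1.

Lemma sum_sqr_dev (f : gT -> R) m : \sum_x f x = 1 ->
  N * (\sum_x (f x - m) ^+ 2) = chi2 f + (1 - N * m) ^+ 2.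
Proof.
move=> f1; have -> : \sum_x (f x - m) ^+ 2 =
    \sum_x f x ^+ 2 - 2 * m * (\sum_x f x) + N * m ^+ 2.
  rewrite mulr_sumr -sumrB [N * _]mulr_natl -sumr_const -big_split /=.
  by apply: eq_bigr => x _; ring.
by rewrite f1 /chi2; ring.
Qed.

Lemma chi2_ge0 (f : gT -> R) : \sum_x f x = 1 -> 0 <= chi2 f.
Proof.
move=> /(sum_sqr_dev N^-1); rewrite divff ?gt_eqF ?card_gT_gt0 //.
rewrite subrr expr0n addr0 => <-.
by apply: mulr_ge0 => //; apply: sumr_ge0 => x _; exact: sqr_ge0.
Qed.

(** A median is the least value of [f] that is exceeded on at most half of the
    points: were it larger than the values taken on a majority, the largest of
    those values would do as well. *)
Lemma median (f : gT -> R) : exists m,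
  (#|[set x | (m < f x)%R]|.*2 <= #|gT|)%N /\
  (#|[set x | (f x < m)%R]|.*2 <= #|gT|)%N.
Proof.
pose P x := (#|[set y | (f x < f y)%R]|.*2 <= #|gT|)%N.
have [a _ amax] := @arg_maxP _ _ _ (1%g : gT) xpredT f isT.
have Pa : P a.
  rewrite /P (_ : [set y | _] = finset.set0) ?cards0 //.
  by apply/setP => y; rewrite !inE ltNge; apply/negbF; exact: amax.
have [b Pb bmin] := arg_minP f Pa.
exists (f b); split => //; rewrite leqNgt; apply/negP => big.
have [c cL] : exists c, c \in [set x | f x < f b].
  by apply/set0Pn; apply: contraTneq big => ->; rewrite cards0.
have [e' eL emax] := arg_maxP f cL.
have {eL} : e' \in [set x | f x < f b] by exact: eL.
rewrite inE => elt.
have Pe : P e'.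
  rewrite /P (_ : [set y | _] = ~: [set x | f x < f b]).
    have := cardsC [set x | (f x < f b)%R]; move: big.
    by move: #|[set x | (f x < f b)%R]| #|~: _| #|gT| => u v w; lia.
  apply/setP => y; rewrite !inE -leNgt; apply/idP/idP => [ey|by_]; last first.
    exact: lt_le_trans by_.
  rewrite leNgt; apply/negP => yb.
  have : y \in [set x | f x < f b] by rewrite inE.
  by move=> /emax /= /(lt_le_trans ey); rewrite ltxx.
by have := bmin _ Pe; rewrite leNgt elt.
Qed.

Lemma card_half (A : {set gT}) : (#|A|.*2 <= #|gT|)%N -> #|A|%:R / N <= 2^-1.
Proof.
move=> A2; rewrite ler_pdivrMr ?card_gT_gt0 // ler_pdivlMl //.
by rewrite -natrM ler_nat mul2n.
Qed.

Lemma dirichlet_pos_part (f g : gT -> R) :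
  (forall x y, (g x - g y) ^+ 2 <= (f x - f y) ^+ 2) ->
  dirichlet mu (fun x => Num.max (g x) 0) <= dirichlet mu f.
Proof.
move=> gf; apply: dirichlet_contraction => // x y; apply: le_trans (gf x y).
move: (g x) (g y) => a b; have := sqr_ge0 (a - b); rewrite /Num.max.
by case: ltrP => h1; case: ltrP => h2; nra.
Qed.

(** Spectral-profile form of the Cheeger inequality. Let [M] be the second
    moment of the density [N * f]. When [M >= 8], truncating [f] below at
    [M / (4 N)] keeps at least half of the second moment, while by Markov's
    inequality the truncated function lives on a set of proportion at most
    [4 / M]. When [M < 8], the argument [4 / M] exceeds [1/2]; the positive
    and negative parts of [f - m], with [m] a median, both live on at most
    half of the group. *)
Lemma dirichlet_chi2 (f : gT -> R) : (forall x, 0 <= f x) ->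
  \sum_x f x = 1 ->
  isoperimetric_profile mu (4 / (N * \sum_x f x ^+ 2)) ^+ 2 * chi2 f
    <= 8 * (N * dirichlet mu f).
Proof.
move=> f0 f1; have N0 := card_gT_gt0; have c0 := chi2_ge0 f1.
set k := isoperimetric_profile _ _.
have k0 : 0 <= k by exact: isoperimetric_profile_ge0.
have M1 : 1 <= N * \sum_x f x ^+ 2 by rewrite -subr_ge0.
have MN0 : 0 < N * \sum_x f x ^+ 2 by exact: lt_le_trans M1.
have [M8|M8] := lerP 8 (N * \sum_x f x ^+ 2).
  set M := N * \sum_x f x ^+ 2 in M1 M8 MN0.
  (* the truncation level is a quarter of the mean of the density under f *)
  pose t := M / (4 * N); have t0 : 0 < t by apply: divr_gt0 => //; apply: mulr_gt0.
  pose g x := Num.max (f x - t) 0.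
  have gE : dirichlet mu g <= dirichlet mu f.
    by apply: dirichlet_pos_part => x y; rewrite opprB addrA subrK.
  have : k ^+ 2 * (\sum_x g x ^+ 2) <= 4 * dirichlet mu g.
    apply: cheeger => // [x|A A0 Ag]; first by rewrite /g le_max lexx orbT.
    have Ar : #|A|%:R / N <= 4 / M.
      have tA : t * #|A|%:R <= 1.
        rewrite -[leRHS]f1 -sum1_card natr_sum mulr_sumr big_mkcond /=.
        apply: ler_sum => x _; case: ifP => // /Ag.
        by rewrite /g lt_max ltxx orbF subr_gt0 mulr1 => /ltW.
      rewrite ler_pdivrMr // mulrAC ler_pdivlMr //.
      have -> : M = t * (4 * N) by rewrite mulfVK // gt_eqF // mulr_gt0.
      by rewrite [leLHS]mulrA [_ * t]mulrC; apply: ler_piMl => //;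
        rewrite mulr_ge0 // ltW.
    apply: isoperimetric_profile_le => //; apply: le_trans Ar _.
    by rewrite ler_pdivrMr // ler_pdivlMl //; lra.
  have g2 : \sum_x f x ^+ 2 - 2 * t <= \sum_x g x ^+ 2.
    have -> : 2 * t = 2 * t * \sum_x f x by rewrite f1 mulr1.
    rewrite mulr_sumr -sumrB; apply: ler_sum => x _.
    have := f0 x; rewrite /g /Num.max; move: (f x) => a a0.
    case: ltrP => h; nra.
  have {g2} g2 : M / 2 <= N * \sum_x g x ^+ 2.
    apply: le_trans (ler_wpM2l (ltW N0) g2).
    rewrite mulrBr -/M /t le_eqVlt; apply/orP; left; apply/eqP.
    by field; rewrite gt_eqF.
  have -> : chi2 f = M - 1 by [].
  have k2 := sqr_ge0 k; move: (k ^+ 2) k2 => K K0 H.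
  have H1 := ler_wpM2l (ltW N0) H.
  have H2 := ler_wpM2l K0 g2.
  have H3 := ler_wpM2l (ltW N0) gE.
  by nra.
have kE : k = isoperimetric_profile mu 2^-1.
  rewrite /k /isoperimetric_profile lexx ifF //.
  by apply/negbTE; rewrite -ltNge ltr_pdivlMr // ltr_pdivrMl //; lra.
have [m [mr ml]] := median f.
have half (g : gT -> R) : (forall x, 0 <= g x) ->
    (#|[set x | (0 < g x)%R]|.*2 <= #|gT|)%N ->
    dirichlet mu g <= dirichlet mu f ->
    k ^+ 2 * (\sum_x g x ^+ 2) <= 4 * dirichlet mu f.
  move=> g0 g2 gE; apply: le_trans (ler_wpM2l _ gE) => //.
  apply: cheeger => // A A0 Ag; rewrite kE.
  have A2 : #|A|%:R / N <= 2^-1.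
    apply: card_half; apply: leq_trans g2; rewrite leq_double.
    by apply: subset_leq_card; apply/fintype.subsetP => x xA; rewrite inE Ag.
  exact: isoperimetric_profile_le.
have H1 : k ^+ 2 * (\sum_x Num.max (f x - m) 0 ^+ 2) <= 4 * dirichlet mu f.
  apply: half => [x||]; first by rewrite le_max lexx orbT.
    apply: leq_trans mr; rewrite leq_double subset_leq_card //.
    by apply/fintype.subsetP => x; rewrite !inE lt_max ltxx orbF subr_gt0.
  by apply: dirichlet_pos_part => x y; rewrite opprB addrA subrK.
have H2 : k ^+ 2 * (\sum_x Num.max (m - f x) 0 ^+ 2) <= 4 * dirichlet mu f.
  apply: half => [x||]; first by rewrite le_max lexx orbT.
    apply: leq_trans ml; rewrite leq_double subset_leq_card //.
    by apply/fintype.subsetP => x; rewrite !inE lt_max ltxx orbF subr_gt0.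
  apply: dirichlet_pos_part => x y.
  by rewrite le_eqVlt; apply/orP; left; apply/eqP; ring.
have H3 : k ^+ 2 * (\sum_x (f x - m) ^+ 2) <= 8 * dirichlet mu f.
  have -> : \sum_x (f x - m) ^+ 2 = \sum_x Num.max (f x - m) 0 ^+ 2
      + \sum_x Num.max (m - f x) 0 ^+ 2.
    rewrite -big_split; apply: eq_bigr => x _ /=; rewrite /Num.max.
    by case: ltrP => h1; case: ltrP => h2; nra.
  by rewrite mulrDr; lra.
apply: (@le_trans _ _ (k ^+ 2 * (N * \sum_x (f x - m) ^+ 2))).
  apply: ler_wpM2l; first exact: sqr_ge0.
  by rewrite (sum_sqr_dev m f1) lerDl sqr_ge0.
by rewrite mulrCA [8 * _]mulrCA; apply: ler_wpM2l => //; exact: ltW.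
Qed.

End Profile.

(** * One fresh step contracts the chi-square distance *)

Section Convolution.
Context {R : realType} {gT : finGroupType} (mu : gT -> R).
Context (mu_pmf : is_pmf mu) (mu0 : R) (mu0_gt0 : 0 < mu0).
Context (mu0_le : mu0 <= mu 1%g).

Local Notation N := (#|gT|%:R : R).

Definition convolve (f : gT -> R) (x : gT) : R :=
  \sum_g mu g * f (x * g^-1)%g.

Lemma sum_mulgr (f : gT -> R) g : \sum_x f (x * g)%g = \sum_x f x.
Proof. by rewrite [RHS](reindex_inj (mulIg g)). Qed.

Lemma convolve_sum f : \sum_x convolve f x = \sum_x f x.
Proof.
rewrite exchange_big /= -[RHS]mul1r -mu_pmf.2 mulr_suml.
by apply: eq_bigr => g _; rewrite -mulr_sumr sum_mulgr.
Qed.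

Lemma convolve_ge0 (f : gT -> R) :
  (forall x, 0 <= f x) -> forall x, 0 <= convolve f x.
Proof.
by move=> f0 x; apply: sumr_ge0 => g _; rewrite mulr_ge0 ?mu_pmf.1.
Qed.

Lemma pmf_le1 x : mu x <= 1.
Proof.
rewrite -mu_pmf.2 (bigD1 x) //= lerDl.
by apply: sumr_ge0 => y _; exact: mu_pmf.1.
Qed.

(** The term at the identity alone contributes [mu0 * (m - a 1)^2] to the
    variance, so moving the centre from the mean [m] to [a 1] costs at most a
    factor [1 + 1 / mu0 <= 2 / mu0]. *)
Lemma variance_ge (a : gT -> R) :
  mu0 / 2 * (\sum_g mu g * (a g - a 1%g) ^+ 2) <=
  \sum_g mu g * a g ^+ 2 - (\sum_g mu g * a g) ^+ 2.
Proof.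
set m := \sum_g mu g * a g.
have dev c : \sum_g mu g * (a g - c) ^+ 2 =
    (\sum_g mu g * a g ^+ 2 - m ^+ 2) + (m - c) ^+ 2.
  have -> : \sum_g mu g * (a g - c) ^+ 2 = \sum_g mu g * a g ^+ 2
      - 2 * c * m + c ^+ 2 * (\sum_g mu g).
    rewrite !mulr_sumr -sumrB -big_split /=.
    by apply: eq_bigr => g _; ring.
  by rewrite mu_pmf.2; ring.
have V1 : mu0 * (m - a 1%g) ^+ 2 <= \sum_g mu g * a g ^+ 2 - m ^+ 2.
  have := dev m; rewrite subrr expr0n addr0 => <-.
  rewrite (bigD1 1%g) //= -[leLHS]addr0; apply: lerD.
    by rewrite -sqrrN opprB; apply: ler_wpM2r => //; exact: sqr_ge0.
  by apply: sumr_ge0 => g _; rewrite mulr_ge0 ?mu_pmf.1 ?sqr_ge0.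
have V0 : 0 <= \sum_g mu g * a g ^+ 2 - m ^+ 2.
  by apply: le_trans V1; rewrite mulr_ge0 ?sqr_ge0 // ltW.
rewrite dev; have := le_trans mu0_le (pmf_le1 1).
by move: (_ - m ^+ 2) ((m - _) ^+ 2) V0 V1 => V D; nra.
Qed.

(** At each point the loss in the sum of squares is the variance of [f] over
    the possible predecessors. This is where the laziness of [mu] enters: it
    bounds the Dirichlet form of the multiplicative reversibilization from
    below by that of the walk itself. *)
Lemma convolve_dirichlet f :
  mu0 / 2 * dirichlet mu f <=
  \sum_x f x ^+ 2 - \sum_x convolve f x ^+ 2.
Proof.
have -> : dirichlet mu f =
    \sum_x \sum_g mu g * (f (x * g^-1)%g - f (x * 1^-1)%g) ^+ 2.
  rewrite /dirichlet exchange_big /=; apply: eq_bigr => x _.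
  rewrite (reindex (fun g => x * g^-1)%g) /=; last first.
    exists (fun y => y^-1 * x)%g => z _; first by rewrite invMg invgK mulgKV.
    by rewrite invMg invgK mulKVg.
  apply: eq_bigr => g _; rewrite /trans_prob invMg invgK mulgKV.
  by rewrite invg1 mulg1.
have -> : \sum_x f x ^+ 2 = \sum_x \sum_g mu g * f (x * g^-1)%g ^+ 2.
  rewrite -[LHS]mul1r -mu_pmf.2 mulr_suml exchange_big /=.
  apply: eq_bigr => g _; rewrite -mulr_sumr.
  by rewrite (sum_mulgr (fun x => f x ^+ 2)).
rewrite -sumrB mulr_sumr; apply: ler_sum => x _.
exact: (variance_ge (fun g => f (x * g^-1)%g)).
Qed.

Lemma sum_sqr_le1 (f : gT -> R) : (forall x, 0 <= f x) ->
  \sum_x f x = 1 -> \sum_x f x ^+ 2 <= 1.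
Proof.
move=> f0 f1; rewrite -[leRHS]f1; apply: ler_sum => x _.
rewrite expr2; apply: ler_piMr => //.
rewrite -f1 (bigD1 x) //= lerDl.
by apply: sumr_ge0.
Qed.

Lemma convolve_chi2 (f : gT -> R) : (forall x, 0 <= f x) -> \sum_x f x = 1 ->
  0 < chi2 f ->
  chi2 (convolve f) <=
    chi2 f - mu0 / 16 * isoperimetric_profile mu (4 / chi2 f) ^+ 2 * chi2 f.
Proof.
move=> f0 f1 c0; have N0 : 0 < N := card_gT_gt0.
have H1 := ler_wpM2l (ltW N0) (convolve_dirichlet f).
have H2 := dirichlet_chi2 mu_pmf f0 f1.
have : isoperimetric_profile mu (4 / chi2 f) ^+ 2 <=
    isoperimetric_profile mu (4 / (N * \sum_x f x ^+ 2)) ^+ 2.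
  have cM : chi2 f <= N * \sum_x f x ^+ 2 by rewrite /chi2 gerBl.
  have M0 : 0 < N * \sum_x f x ^+ 2 by exact: lt_le_trans cM.
  rewrite ler_sqr ?nnegrE ?isoperimetric_profile_ge0 //.
  apply: isoperimetric_profile_anti => //.
    rewrite -[N^-1]mul1r ler_pdivrMr // mulrAC ler_pdivlMr //.
    have := ler_wpM2l (ltW N0) (sum_sqr_le1 f0 f1); nra.
  by rewrite ler_pM2l // lef_pV2 ?posrE.
move: H1 H2 c0; rewrite /chi2.
move: (isoperimetric_profile _ _ ^+ 2) (isoperimetric_profile _ _ ^+ 2) => K L.
set M := N * \sum_x f x ^+ 2; set M' := N * \sum_x convolve f x ^+ 2.
set E := dirichlet mu f => H1 H2 c0 KL.
have H3 : K * (M - 1) <= 8 * (N * E).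
  by apply: le_trans H2; apply: ler_wpM2r => //; exact: ltW.
have H4 : mu0 * (K * (M - 1)) <= mu0 * (8 * (N * E)).
  by apply: ler_wpM2l => //; exact: ltW.
have H5 : mu0 / 2 * (N * E) <= M - M'.
  by move: H1; rewrite mulrBr mulrCA -/M -/M'.
by lra.
Qed.

End Convolution.

(** * Lower bounds for the profile integral *)

Section ProfileIntegral.
Context {R : realType} {gT : finGroupType} (mu : gT -> R).
Context (mu_pmf : is_pmf mu) (gT_gt1 : (2 <= #|gT|)%N).
Context (profile_neq0 : isoperimetric_profile mu 2^-1 != 0).

Local Notation N := (#|gT|%:R : R).
Local Notation Phi := (isoperimetric_profile mu).

Lemma profile_gt0 r : N^-1 <= r -> 0 < Phi r.
Proof.
move=> Nr; apply: (@lt_le_trans _ _ (Phi (Num.max r 2^-1))); last first.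
  by apply: isoperimetric_profile_anti => //; rewrite le_max lexx.
rewrite (_ : Phi (Num.max r 2^-1) = Phi 2^-1).
  by rewrite lt0r profile_neq0 isoperimetric_profile_ge0.
by rewrite /isoperimetric_profile lexx /Num.max; case: ltrP => // h;
  case: ifP => // r2; congr profile_below; apply/eqP; rewrite eq_le h r2.
Qed.

Lemma profile_le1 r : N^-1 <= r -> Phi r <= 1.
Proof.
move=> Nr; have := @isoperimetric_profile_le _ _ _ mu_pmf r [set 1%g].
rewrite cards1 mul1r mulr1 => /(_ isT Nr) H.
apply: le_trans (H _) _; first by rewrite lef_pV2 ?posrE ?card_gT_gt0 // ler_nat.
rewrite /trans_flow big_set1 -(trans_prob_row mu_pmf 1%g) big_mkcond /=.
by apply: ler_sum => y _; case: ifP => // _; exact: trans_prob_ge0.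
Qed.

Definition profile_integrand (s : R) : \bar R := ((s * Phi s ^+ 2)^-1)%:E.

Definition profile_tail (b u : R) : \bar R :=
  (\int[lebesgue_measure]_(s in `[u, b]) profile_integrand s)%E.

(** The integrand is the product of the decreasing function [1 / s] and of the
    increasing function [1 / Phi s ^ 2]; both are extended monotonically below
    [1 / N] by replacing [s] with the maximum of [s] and [1 / N]. *)
Lemma profile_integrand_measurable (D : set R) : measurable D ->
  (forall s, D s -> N^-1 <= s) -> measurable_fun D profile_integrand.
Proof.
move=> mD DN; apply/measurable_EFinP.
have Nm s : N^-1 <= Num.max s N^-1 by rewrite le_max lexx orbT.
have m0 s : 0 < Num.max s N^-1.
  by apply: lt_le_trans (Nm s); rewrite invr_gt0 card_gT_gt0.
have mm s t : s <= t -> Num.max s N^-1 <= Num.max t N^-1.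
  by move=> st; rewrite ge_max !le_max st lexx orbT.
apply: (@eq_measurable_fun _ _ _ _ D
    (fun s : R => (Num.max s N^-1)^-1 * (Phi (Num.max s N^-1) ^+ 2)^-1)).
  by move=> s; rewrite inE => /DN sN; rewrite max_l // [RHS]invfM.
apply: measurable_funM.
  apply: nonincreasing_measurable => // s t st.
  by rewrite lef_pV2 ?posrE ?m0 // mm.
apply: nondecreasing_measurable => // s t st.
rewrite lef_pV2 ?posrE ?exprn_gt0 ?profile_gt0 //.
by rewrite ler_sqr ?nnegrE ?isoperimetric_profile_ge0
  ?isoperimetric_profile_anti ?mm.
Qed.

(** On the interval from [u] to [v] the integrand is at least
    [1 / (v * Phi u ^ 2)], as [Phi] decreases. Using [1 - u / v] in place of
    the logarithm of [v / u] is what makes a contraction by the factor [1 - x]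
    consume at least [x / Phi u ^ 2] of the integral. *)
Lemma profile_tail_cell b u v : N^-1 <= u -> u <= v -> v <= b ->
  (((1 - u / v) / Phi u ^+ 2)%:E + profile_tail b v <= profile_tail b u)%E.
Proof.
move=> Nu uv vb.
have u0 : 0 < u by apply: lt_le_trans Nu; rewrite invr_gt0 card_gT_gt0.
have v0 : 0 < v by exact: lt_le_trans uv.
have F0 s : N^-1 <= s -> (0 <= profile_integrand s)%E.
  move=> Ns; rewrite lee_fin invr_ge0 mulr_ge0 ?sqr_ge0 //.
  by apply: le_trans Ns; rewrite invr_ge0.
have mF (i : interval R) : (i <= `[u, +oo[)%O ->
    measurable_fun [set` i] profile_integrand.
  move=> iu; apply: profile_integrand_measurable => // s /= si.
  by have := subitvP iu si; rewrite in_itv /= andbT; exact: le_trans.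
have e : (`[u, b] = `[u, v[ `|` `[v, b])%classic.
  by rewrite -itv_bndbnd_setU // bnd_simp.
rewrite /profile_tail [in leRHS]e ge0_integral_setU //; last 3 first.
- by rewrite -e; apply: mF; rewrite subitvE /= bnd_simp lexx.
- move=> s; rewrite -e /= in_itv /= => /andP[us _]; apply: F0; exact: le_trans us.
- apply/disj_setPS => s [] /=; rewrite !in_itv /= => /andP[_ sv] /andP[vs _].
  by have := lt_le_trans sv vs; rewrite ltxx.
apply: leeD => //.
pose c := (v * Phi u ^+ 2)^-1.
have Pu := profile_gt0 Nu.
have -> : ((1 - u / v) / Phi u ^+ 2)%:E =
    (\int[lebesgue_measure]_(s in `[u, v[) (cst c%:E s))%E.
  rewrite integral_cst //= lebesgue_measure_itv /= lte_fin.
  case: ltP => [uv'|vu]; last first.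
    have -> : v = u by apply/eqP; rewrite eq_le uv vu.
    by rewrite divff ?gt_eqF // subrr mul0r mule0.
  rewrite -EFinB -EFinM /c; congr EFin.
  by field; rewrite !gt_eqF.
apply: ge0_le_integral => //.
- by move=> s _; rewrite lee_fin invr_ge0 mulr_ge0 ?sqr_ge0 // ltW.
- by apply: mF; rewrite subitvE /= bnd_simp lexx.
move=> s /=; rewrite in_itv /= => /andP[us sv].
have Ns := le_trans Nu us; have s0 := lt_le_trans u0 us.
rewrite lee_fin lef_pV2 ?posrE ?mulr_gt0 ?exprn_gt0 ?profile_gt0 //.
apply: ler_pM; [exact: ltW|exact: sqr_ge0|exact: ltW|].
by rewrite ler_sqr ?nnegrE ?isoperimetric_profile_ge0 //
  isoperimetric_profile_anti.
Qed.

Lemma profile_tail_ge0 b u : N^-1 <= u -> (0 <= profile_tail b u)%E.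
Proof.
move=> Nu; apply: integral_ge0 => s /=; rewrite in_itv /= => /andP[us _].
rewrite lee_fin invr_ge0 mulr_ge0 ?sqr_ge0 //.
by apply: le_trans us; apply: le_trans Nu; rewrite invr_ge0.
Qed.

(** The integral dominates a logarithm, since [Phi <= 1]: each doubling of the
    argument contributes at least one half. *)
Lemma profile_tail_doubling b u j : N^-1 <= u -> u * 2 ^+ j <= b ->
  ((j%:R / 2)%:E <= profile_tail b u)%E.
Proof.
elim: j u => [|j IHj] u Nu ub; first by rewrite mul0r profile_tail_ge0.
have u0 : 0 < u by apply: lt_le_trans Nu; rewrite invr_gt0 card_gT_gt0.
have ub' : 2 * u <= b.
  apply: le_trans ub; rewrite mulrC ler_pM2l // exprS ler_peMr //.
  by rewrite exprn_ege1 // ler1n.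
have uu : u <= 2 * u by rewrite ler_peMl ?ler1n // ltW.
have := IHj (2 * u) (le_trans Nu uu).
rewrite [2 * u]mulrC -mulrA -exprS [u * 2]mulrC => /(_ ub) IH.
apply: le_trans (profile_tail_cell Nu uu ub').
rewrite (_ : j.+1%:R / 2 = 2^-1 + j%:R / 2 :> R); last by rewrite -natr1; ring.
rewrite EFinD; apply: leeD => //; rewrite lee_fin.
rewrite (_ : 1 - u / (2 * u) = 2^-1); last by field; rewrite gt_eqF.
have P1 := profile_le1 Nu; have P0 := profile_gt0 Nu.
rewrite ler_peMr // invf_ge1 ?exprn_gt0 //.
by rewrite expr_le1 // ltW.
Qed.

End ProfileIntegral.

(** * Walks alternating fresh and prescribed steps *)

Section Walk.
Context {R : realType} {gT : finGroupType}.
Implicit Types (mu f h : gT -> R) (o : seq (option gT)).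

Local Notation N := (#|gT|%:R : R).

(** A step is either fresh, with law [mu], or multiplication by a prescribed
    group element; the latter permutes the values of [f]. *)
Definition walk_step mu f (a : option gT) : gT -> R :=
  if a is Some g then fun x => f (x * g^-1)%g else convolve mu f.

Definition walk mu f o : gT -> R := foldl (walk_step mu) f o.

Definition point_mass (x : gT) : gT -> R := fun y => (y == x)%:R.

Lemma walk_rcons mu f o a : walk mu f (rcons o a) = walk_step mu (walk mu f o) a.
Proof. by rewrite /walk -cats1 foldl_cat. Qed.

Lemma walk_ge0 mu f o : is_pmf mu -> (forall x, 0 <= f x) ->
  forall x, 0 <= walk mu f o x.
Proof.
move=> mu_pmf; elim: o f => //= -[g|] o IHo f f0; apply: IHo => x /=.
  exact: f0.
exact: convolve_ge0.
Qed.

Lemma walk_sum mu f o : is_pmf mu -> \sum_x walk mu f o x = \sum_x f x.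
Proof.
move=> mu_pmf; elim: o f => //= -[g|] o IHo f; rewrite IHo.
  by rewrite /= sum_mulgr.
exact: convolve_sum.
Qed.

Lemma sum_point_mass x : \sum_y point_mass x y = 1.
Proof.
rewrite (bigD1 x) //= /point_mass eqxx big1 ?addr0 // => y.
by case: eqP.
Qed.

Lemma chi2_point_mass x : chi2 (point_mass x) = N - 1.
Proof.
rewrite /chi2 (bigD1 x) //= /point_mass eqxx big1.
  by rewrite addr0 expr1n mulr1.
by move=> y; case: eqP => //= _ _; rewrite expr0n.
Qed.

Section Contraction.
Context mu (mu_pmf : is_pmf mu) (mu0 : R) (mu0_gt0 : 0 < mu0).
Context (mu0_le : mu0 <= mu 1%g) (gT_gt1 : (2 <= #|gT|)%N).
Context (profile_neq0 : isoperimetric_profile mu 2^-1 != 0).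

Lemma convolve_chi2_le f : chi2 (convolve mu f) <= chi2 f.
Proof.
rewrite /chi2 lerD2r; apply: ler_wpM2l => //; rewrite -subr_ge0.
apply: le_trans (convolve_dirichlet mu_pmf mu0_gt0 mu0_le f).
rewrite mulr_ge0 ?divr_ge0 ?(ltW mu0_gt0) //.
apply: sumr_ge0 => x _; apply: sumr_ge0 => y _.
by rewrite mulr_ge0 ?sqr_ge0 ?trans_prob_ge0.
Qed.

(** With [u = 4 / chi2], prescribed steps leave [u] unchanged and every fresh
    step moves [u] to the right by enough to consume at least [mu0 / 16] of
    the profile integral, until the chi-square distance has dropped below
    [4 / b]. *)
Lemma walk_chi2 (b : R) f o : 0 < b -> (forall x, 0 <= f x) -> \sum_x f x = 1 ->
  chi2 (walk mu f o) <= 4 / b \/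
  ((mu0 / 16 * (count_mem None o)%:R)%:E
    + profile_tail mu b (4 / chi2 (walk mu f o))
    <= profile_tail mu b (4 / chi2 f))%E.
Proof.
move=> b0 f0 f1; have N0 : 0 < N := card_gT_gt0.
elim/last_ind: o => [|o a IHo]; first by right; rewrite mulr0 add0e.
rewrite walk_rcons -cats1 count_cat /=; case: a => [g|] /=.
  have -> : chi2 (fun x => walk mu f o (x * g^-1)%g) = chi2 (walk mu f o).
    by rewrite /chi2 (sum_mulgr (fun x => walk mu f o x ^+ 2)).
  by rewrite !addn0.
have le := convolve_chi2_le (walk mu f o).
case: IHo => [v4|IHo]; [by left; exact: le_trans v4 | rewrite addn0].
have w0 := @walk_ge0 mu f o mu_pmf f0.
have w1 : \sum_x walk mu f o x = 1 by rewrite walk_sum.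
have [v4|v4] := lerP (chi2 (convolve mu (walk mu f o))) (4 / b); [by left|right].
have v'0 : 0 < chi2 (convolve mu (walk mu f o)).
  by apply: lt_trans v4; rewrite divr_gt0.
have v0 := lt_le_trans v'0 le.
have step := convolve_chi2 mu_pmf mu0_gt0 mu0_le w0 w1 v0.
move: le v4 v'0 v0 step IHo.
have vN : chi2 (walk mu f o) <= N.
  have := ler_wpM2l (ltW N0) (sum_sqr_le1 w0 w1); rewrite mulr1 /chi2.
  by move: (N * _) => M; lra.
move: (chi2 (convolve _ _)) (chi2 (walk mu f o)) vN => v' v vN le v4 v'0 v0 step.
move=> IHo; apply: le_trans IHo.
have uN : N^-1 <= 4 / v.
  by rewrite -[N^-1]mul1r ler_pdivrMr // mulrAC ler_pdivlMr //; lra.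
have uu : 4 / v <= 4 / v' by rewrite ler_pM2l // lef_pV2 ?posrE.
have ub : 4 / v' <= b.
  by move: v4; rewrite ltr_pdivrMr // ler_pdivrMr // mulrC => /ltW.
have cell := profile_tail_cell mu_pmf profile_neq0 uN uu ub.
rewrite natrD mulrDr mulr1 EFinD -addeA leeD2l //; apply: le_trans cell.
rewrite leeD2r // lee_fin ler_pdivlMr ?exprn_gt0 ?profile_gt0 //.
rewrite (_ : 4 / v / (4 / v') = v' / v); last first.
  by field; rewrite !gt_eqF.
rewrite -(ler_pM2r v0) mulrBl mul1r divfK ?gt_eqF //.
by lra.
Qed.

Lemma walk_mixes (b : R) o (x : gT) : 4 <= b ->
  (profile_tail mu b (4 / N) < (mu0 / 16 * (count_mem None o)%:R)%:E)%E ->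
  chi2 (walk mu (point_mass x) o) <= 4 / b.
Proof.
move=> b4 tail; have N0 : 0 < N := card_gT_gt0.
have N2 : 2 <= N by rewrite ler_nat.
have b0 : 0 < b by lra.
have p0 y : 0 <= point_mass x y by rewrite /point_mass ler0n.
have [//|H] := walk_chi2 o b0 p0 (sum_point_mass x).
have wN : chi2 (walk mu (point_mass x) o) <= N.
  have := sum_sqr_le1 (walk_ge0 o mu_pmf p0).
  rewrite walk_sum // => /(_ (sum_point_mass x)) /(ler_wpM2l (ltW N0)).
  by rewrite mulr1 /chi2; lra.
rewrite leNgt; apply/negP => big.
have w0 : 0 < chi2 (walk mu (point_mass x) o).
  by apply: lt_trans big; rewrite divr_gt0.
have tail0 := @profile_tail_ge0 _ _ mu b (4 / chi2 (walk mu (point_mass x) o)).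
have {tail0} H0 : ((mu0 / 16 * (count_mem None o)%:R)%:E
    <= profile_tail mu b (4 / chi2 (point_mass x)))%E.
  apply: le_trans H; rewrite leeDl // tail0 //.
  by rewrite -[N^-1]mul1r ler_pdivrMr // mulrAC ler_pdivlMr //; lra.
have N1 : N^-1 <= 4 / N by rewrite ler_pMl ?invr_gt0 //; lra.
have N12 : 4 / N <= 4 / (N - 1) by rewrite ler_pM2l // lef_pV2 ?posrE //; lra.
have Nb : 4 / (N - 1) <= b.
  by rewrite ler_pdivrMr; [nra | lra].
have := profile_tail_cell mu_pmf profile_neq0 N1 N12 Nb.
rewrite -(chi2_point_mass x) => cell.
have {}cell : (profile_tail mu b (4 / chi2 (point_mass x))
    <= profile_tail mu b (4 / N))%E.
  apply: le_trans cell; rewrite leeDr // lee_fin divr_ge0 ?sqr_ge0 //.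
  have ? : 0 < 4 / chi2 (point_mass x).
    by rewrite chi2_point_mass divr_gt0 //; lra.
  by rewrite subr_ge0 ler_pdivrMr // mul1r chi2_point_mass.
by have := lt_le_trans tail (le_trans H0 cell); rewrite ltxx.
Qed.

End Contraction.
End Walk.

(** * From chi-square to uniform distance *)

Section Duality.
Context {R : realType} {gT : finGroupType}.
Implicit Types (mu f h : gT -> R) (o : seq (option gT)).

Local Notation N := (#|gT|%:R : R).

Definition reversed mu : gT -> R := fun g => mu g^-1%g.

Lemma reversed_pmf mu : is_pmf mu -> is_pmf (reversed mu).
Proof.
move=> [mu_ge0 mu_sum]; split=> [x|]; first exact: mu_ge0.
by rewrite -mu_sum [RHS](reindex_inj invg_inj).
Qed.

(** The reversed walk has its flows transposed, and the flow out of a set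
    equals the flow into it. *)
Lemma reversed_profile mu r : is_pmf mu ->
  isoperimetric_profile (reversed mu) r = isoperimetric_profile mu r.
Proof.
move=> mu_pmf.
have E (A : {set gT}) : bottleneck (reversed mu) A = bottleneck mu A.
  rewrite /bottleneck -[in RHS](trans_flow_setC mu_pmf) /trans_flow exchange_big /=.
  congr (_ / _); apply: eq_bigr => x _; apply: eq_bigr => y _.
  by rewrite /trans_prob /reversed invMg invgK.
rewrite /isoperimetric_profile /profile_below.
by congr (if _ then inf _ else inf _); apply: eq_imagel => A _; exact: E.
Qed.

Lemma reversed_tail mu b u : is_pmf mu ->
  profile_tail (reversed mu) b u = profile_tail mu b u.
Proof.
move=> mu_pmf; rewrite /profile_tail; apply: eq_integral => s _.
by rewrite /profile_integrand reversed_profile.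
Qed.

Lemma walk_step_adjoint mu f h a :
  \sum_x walk_step mu f a x * h x =
  \sum_x f x * walk_step (reversed mu) h (omap (@invg gT) a) x.
Proof.
case: a => [g|] /=.
  rewrite -(sum_mulgr _ g) /=; apply: eq_bigr => x _.
  by rewrite mulgK invgK.
rewrite /convolve (eq_bigr _ (fun x _ => mulr_suml _ _ _ _)) exchange_big /=.
rewrite [RHS](eq_bigr _ (fun x _ => mulr_sumr _ _ _ _)) [RHS]exchange_big /=.
rewrite [RHS](reindex_inj invg_inj); apply: eq_bigr => g _ /=.
rewrite -(sum_mulgr _ g) /=; apply: eq_bigr => x _.
by rewrite mulgK /reversed invgK -mulrA mulrCA.
Qed.

Lemma walk_adjoint mu f h o :
  \sum_x walk mu f o x * h x =
  \sum_x f x * walk (reversed mu) h (rev (map (omap (@invg gT)) o)) x.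
Proof.
elim: o f => [|a o IHo] f //=.
by rewrite IHo walk_step_adjoint rev_cons walk_rcons.
Qed.

(** Cauchy-Schwarz for the centred densities, in the form
    [2 `|a b| <= a^2 + b^2]. *)
Lemma sum_mulr_uniform f h d : \sum_x f x = 1 -> \sum_x h x = 1 ->
  chi2 f <= d -> chi2 h <= d -> `| N * (\sum_x f x * h x) - 1 | <= d.
Proof.
move=> f1 h1 fd hd; have N0 : 0 < N := card_gT_gt0.
have -> : N * (\sum_x f x * h x) - 1 =
    N * \sum_x (f x - N^-1) * (h x - N^-1).
  have -> : \sum_x (f x - N^-1) * (h x - N^-1) =
      \sum_x f x * h x - N^-1 * (\sum_x f x) - N^-1 * (\sum_x h x)
      + N * (N^-1 ^+ 2).
    have -> : N * (N^-1 ^+ 2) = \sum_(x : gT) N^-1 ^+ 2.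
      by rewrite sumr_const mulr_natl.
    rewrite !mulr_sumr -!sumrB -big_split /=.
    by apply: eq_bigr => x _; ring.
  by rewrite f1 h1; field; rewrite gt_eqF.
rewrite normrM gtr0_norm //.
apply: (@le_trans _ _ (N * \sum_x
    ((f x - N^-1) ^+ 2 + (h x - N^-1) ^+ 2) / 2)).
  apply: ler_wpM2l; first exact: ltW.
  apply: le_trans (ler_norm_sum _ _ _) _; apply: ler_sum => x _.
  rewrite normrM -[X in _ <= (X + _) / 2]real_normK ?num_real //.
  rewrite -[X in _ <= (_ + X) / 2]real_normK ?num_real //.
  have := sqr_ge0 (`|f x - N^-1| - `|h x - N^-1|).
  by move: `|_| `|_| => u v; rewrite sqrrB; lra.
rewrite -mulr_suml big_split /= mulrA mulrDr !sum_sqr_dev //.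
by rewrite divff ?gt_eqF // subrr expr0n !addr0; lra.
Qed.

Lemma count_split (T : eqType) (p : pred T) (s : seq T) k :
  (k <= count p s)%N -> exists i, count p (take i s) = k.
Proof.
elim: s k => [|x s IHs] k /=; first by rewrite leqn0 => /eqP ->; exists 0%N.
case: k => [|k]; first by exists 0%N.
case: (boolP (p x)) => px kx.
  have [i <-] := IHs k kx; by exists i.+1; rewrite /= px.
have [i <-] := IHs k.+1 kx; by exists i.+1; rewrite /= (negbTE px).
Qed.

(** The walk is cut at a time when [k] fresh steps are done and at least [k]
    are left. The mass at [x] is the scalar product of the law at that time
    with the law of the reversed walk issued from [x] over the remaining
    steps, and both are close to uniform in chi-square. *)
Lemma walk_uniform mu (mu0 b : R) o (x : gT) (k : nat) :
  is_pmf mu -> 0 < mu0 -> mu0 <= mu 1%g -> (2 <= #|gT|)%N ->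
  isoperimetric_profile mu 2^-1 != 0 -> 4 <= b ->
  (profile_tail mu b (4 / N) < (mu0 / 16 * k%:R)%:E)%E ->
  (k.*2 <= count_mem None o)%N ->
  `| N * walk mu (point_mass 1%g) o x - 1 | <= 4 / b.
Proof.
move=> mu_pmf mu0_gt0 mu0_le G1 Phi0 b4 tail ko.
have [i ik] : exists i, count_mem None (take i o) = k.
  by apply: count_split; apply: leq_trans ko; rewrite -addnn leq_addr.
have ck : (k <= count_mem None (drop i o))%N.
  by move: ko; rewrite -{1}(cat_take_drop i o) count_cat ik -addnn leq_add2l.
have -> : walk mu (point_mass 1%g) o x =
    \sum_y walk mu (walk mu (point_mass 1%g) (take i o)) (drop i o) y
      * point_mass x y.
  rewrite (bigD1 x) //= /point_mass eqxx mulr1 big1 ?addr0; last first.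
    by move=> y /negbTE ->; rewrite mulr0.
  by rewrite /walk -foldl_cat cat_take_drop.
rewrite walk_adjoint; set o' := rev _.
have co' : (k <= count_mem None o')%N.
  apply: leq_trans ck _; rewrite count_rev count_map.
  by apply: sub_count => -[].
have rpmf := reversed_pmf mu_pmf.
apply: sum_mulr_uniform.
- by rewrite walk_sum // sum_point_mass.
- by rewrite walk_sum // sum_point_mass.
- by apply: (@walk_mixes _ _ _ mu_pmf mu0) => //; rewrite ik.
- apply: (@walk_mixes _ _ _ rpmf mu0) => //.
  + by rewrite /reversed invg1.
  + by rewrite reversed_profile.
  + rewrite reversed_tail //; apply: lt_le_trans tail _.
    by rewrite lee_fin ler_pM2l ?divr_gt0 // ler_nat.
Qed.

End Duality.

(** * The random word recording which steps repeat each other *)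

Section Words.
Context {R : realType} (alpha : R) (alpha01 : 0 <= alpha < 1).
Implicit Types (F G : seq nat -> R) (w : seq nat) (r : nat).

(** Expectation over the combinatorial part of the randomness. At time [n.+1]
    the word has [n.+1] letters, one for each step: the letter [r] stands for
    the fresh sample drawn at time [r.+1], and a reinforced step copies the
    letter at a uniformly chosen earlier position. *)
Fixpoint word_mean n F : R :=
  if n is m.+1 then
    word_mean m (fun w => (1 - alpha) * F (rcons w m.+1)
      + \sum_(k < m.+1) alpha / m.+1%:R * F (rcons w (nth 0%N w k)))
  else F [:: 0%N].

Definition is_word n w := (size w == n.+1) && all (fun r => r <= n)%N w.

Lemma is_word_fresh n w : is_word n w -> is_word n.+1 (rcons w n.+1).
Proof.
case/andP => /eqP sw /allP lw; rewrite /is_word size_rcons sw eqxx /=.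
by rewrite all_rcons leqnn /=; apply/allP => r /lw /leqW.
Qed.

Lemma is_word_copy n w k : is_word n w -> (k < n.+1)%N ->
  is_word n.+1 (rcons w (nth 0%N w k)).
Proof.
case/andP => /eqP sw /allP lw kn; rewrite /is_word size_rcons sw eqxx /=.
rewrite all_rcons (leqW (lw _ (mem_nth _ _))) ?sw //=.
by apply/allP => r /lw /leqW.
Qed.

Lemma word_mean_le n F G : (forall w, is_word n w -> F w <= G w) ->
  word_mean n F <= word_mean n G.
Proof.
have /andP[a0 a1] := alpha01.
elim: n F G => [|n IHn] F G FG /=; first exact: FG.
apply: IHn => w wn; apply: lerD.
  by rewrite ler_wpM2l ?subr_ge0 ?(ltW a1) // FG // is_word_fresh.
apply: ler_sum => k _; apply: ler_wpM2l; first by rewrite divr_ge0.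
by rewrite FG // is_word_copy.
Qed.

Lemma eq_word_mean n F G : (forall w, is_word n w -> F w = G w) ->
  word_mean n F = word_mean n G.
Proof.
by move=> FG; apply: le_anti; rewrite !word_mean_le // => w /FG ->.
Qed.

Lemma word_meanD n F G :
  word_mean n (fun w => F w + G w) = word_mean n F + word_mean n G.
Proof.
elim: n F G => //= n IHn F G; rewrite -IHn; apply: eq_word_mean => w _.
rewrite addrACA -mulrDr -big_split /=; congr (_ + _).
by apply: eq_bigr => k _; rewrite mulrDr.
Qed.

Lemma word_meanZ n c F :
  word_mean n (fun w => c * F w) = c * word_mean n F.
Proof.
elim: n F => //= n IHn F; rewrite -IHn; apply: eq_word_mean => w _.
rewrite mulrDr mulr_sumr mulrCA; congr (_ + _).
by apply: eq_bigr => k _; rewrite mulrCA.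
Qed.

Lemma word_mean_cst n c : word_mean n (fun=> c) = c.
Proof.
elim: n => //= n IHn; rewrite -[RHS]IHn; apply: eq_word_mean => w _.
rewrite sumr_const card_ord -[X in _ + X]mulr_natr mulrAC divfK ?pnatr_eq0 //.
by rewrite -mulrDl subrK mul1r.
Qed.

Lemma word_mean_sum n (I : Type) (r : seq I) (F : I -> seq nat -> R) :
  word_mean n (fun w => \sum_(i <- r) F i w) = \sum_(i <- r) word_mean n (F i).
Proof.
elim: r => [|i r IHr].
  rewrite big_nil -[RHS](word_mean_cst n); apply: eq_word_mean => w _.
  by rewrite big_nil.
rewrite big_cons -IHr -word_meanD; apply: eq_word_mean => w _.
by rewrite big_cons.
Qed.

(** A letter used once belongs to a sample that enters the position only once:
    given all other samples, it is a fresh independent step. *)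
Definition single w r := count_mem r w == 1%N.

Definition singles w := count (single w) w.

Lemma singles_fresh w r : r \notin w -> singles (rcons w r) = (singles w).+1.
Proof.
move=> rw; rewrite /singles -cats1 count_cat /= addn0.
have r0 : count_mem r w = 0%N by apply/count_memPn.
rewrite {2}/single count_cat r0 /= eqxx addn1; congr S.
apply: eq_in_count => s sw; rewrite /single count_cat /= addn0.
have /negbTE -> : r != s by apply: contraNneq rw => ->.
by rewrite addn0.
Qed.

Lemma singles_copy w r : (singles w <= singles (rcons w r) + single w r)%N.
Proof.
rewrite /singles -cats1 count_cat.
apply: (@leq_trans (count (single (w ++ [:: r])) w + single w r)); last first.
  by rewrite leq_add2r leq_addr.
pose last_single s := (s == r) && single w r.
apply: (@leq_trans (count (predU (single (w ++ [:: r])) last_single) w)).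
  apply: sub_count => s /= s1; rewrite /last_single /single count_cat /= addn0.
  case: (eqVneq r s) => [->|_]; first by rewrite (eqP s1) orbT.
  by rewrite addn0 (eqP s1).
apply: leq_trans (leq_addr
  (count (predI (single (w ++ [:: r])) last_single) w) _) _.
rewrite count_predUI leq_add2l /last_single.
case: (boolP (single w r)) => rw /=.
  rewrite -(eqP rw); apply: eq_leq; apply: eq_count => s /=; by rewrite andbT.
by rewrite (@eq_count _ _ pred0) ?count_pred0 // => s /=; rewrite andbF.
Qed.

Lemma sum_single n w : is_word n w ->
  \sum_(k < n.+1) (single w (nth 0%N w k))%:R = (singles w)%:R :> R.
Proof.
case/andP => /eqP sw _; rewrite -natr_sum; congr _%:R.
rewrite /singles -sum1_count (big_nth 0%N) sw big_mkord [RHS]big_mkcond /=.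
by apply: eq_bigr => k _; case: ifP.
Qed.

Lemma expR_le_double (x : R) : 0 <= x -> x <= 2^-1 -> expR x - 1 <= 2 * x.
Proof.
move=> x0 x2; have := expR_ge1Dx (- x); rewrite expRN => H.
have e0 := expR_gt0 x.
have : (1 - x) * expR x <= 1.
  by rewrite -ler_pdivlMr // mul1r.
by nra.
Qed.

Lemma expRN_le (x : R) : 0 <= x -> x <= 1 -> expR (- x) <= 1 - x / 2.
Proof.
move=> x0 x1; rewrite expRN.
have H := expR_ge1Dx x.
have e0 := expR_gt0 x.
by rewrite -[_^-1]mul1r ler_pdivrMr //; nra.
Qed.

(** One step of the Laplace transform of the number [s] of single letters. A
    fresh step, of probability [1 - alpha], creates a single letter; a copy
    destroys one with probability [s / n.+1]. The parameter [l] after the step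
    becomes [m] before it, the difference paying for the destroyed letters. *)
Lemma word_step n w (l m : R) : is_word n w ->
  0 <= l -> l <= 2^-1 -> m + 2 * l / n.+1%:R <= l ->
  (1 - alpha) * expR (- (l * (singles (rcons w n.+1))%:R))
  + \sum_(k < n.+1) alpha / n.+1%:R
      * expR (- (l * (singles (rcons w (nth 0%N w k)))%:R))
  <= expR (- ((1 - alpha) * l / 2)) * expR (- (m * (singles w)%:R)).
Proof.
move=> wn l0 l2 ml; have /andP[a0 a1] := alpha01.
have nw : n.+1 \notin w.
  by case/andP: wn => _ /allP lw; apply/negP => /lw; rewrite ltnn.
rewrite singles_fresh //; set s := singles w.
have el := expR_le_double l0 l2.
have el1 : 1 <= expR l by apply: le_trans (expR_ge1Dx l); rewrite lerDl.
set q := s%:R / n.+1%:R * (expR l - 1).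
have q0 : 0 <= q by rewrite mulr_ge0 ?divr_ge0 // subr_ge0.
apply: (@le_trans _ _ (expR (- (l * s%:R)) * ((1 - alpha) * expR (- l)
    + alpha * (1 + q)))).
  rewrite mulrDr; apply: lerD.
    by rewrite mulrCA -expRD -addn1 natrD mulrDr mulr1 opprD.
  rewrite -mulr_sumr.
  have -> : expR (- (l * s%:R)) * (alpha * (1 + q)) =
     alpha / n.+1%:R * \sum_(k < n.+1) (expR (- (l * s%:R)) *
       (1 + (single w (nth 0%N w k))%:R * (expR l - 1))).
    rewrite -mulr_sumr big_split /= sumr_const card_ord -mulr_suml sum_single //.
    by rewrite /q -/s; field; rewrite addrC natr1 pnatr_eq0.
  apply: ler_wpM2l; first by rewrite divr_ge0.
  apply: ler_sum => k _.
  have := singles_copy w (nth 0%N w k); rewrite -/s.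
  case: (single w _) => /= H; rewrite ?mul1r ?mul0r ?addr0 ?mulr1.
    rewrite addrC subrK -expRD ler_expR.
    have : s%:R <= (singles (rcons w (nth 0%N w k)))%:R + 1 :> R.
      by rewrite natr1 ler_nat -addn1.
    by nra.
  rewrite ler_expR lerN2; apply: ler_wpM2l => //.
  by rewrite ler_nat -[leqRHS]addn0.
have enl : expR (- l) <= 1 - l / 2 by apply: expRN_le => //; lra.
apply: (@le_trans _ _ (expR (- (l * s%:R)) * expR (- ((1 - alpha) * l / 2) + q))).
  apply: ler_wpM2l; first exact: expR_ge0.
  apply: le_trans (expR_ge1Dx _).
  have := ler_wpM2l (_ : 0 <= 1 - alpha) enl; rewrite subr_ge0 => /(_ (ltW a1)).
  have : alpha * q <= q by rewrite ler_piMl // ltW.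
  by lra.
rewrite -!expRD ler_expR addrCA lerD2l.
have : q <= s%:R * (2 * l / n.+1%:R).
  rewrite [leRHS]mulrCA [leRHS]mulrC.
  by apply: ler_wpM2l => //; rewrite divr_ge0.
have : s%:R * (m + 2 * l / n.+1%:R) <= s%:R * l by rewrite ler_wpM2l.
rewrite mulrDr; move: (2 * l / _) q {q0} => t q.
by move: (s%:R : R) => u; lra.
Qed.

End Words.

(** * Lower tail of the number of single letters *)

Section Chernoff.
Context {R : realType} (alpha : R) (alpha01 : 0 <= alpha < 1).

(** The step lemma lets the Laplace parameter go, backwards in time, from [l]
    to any [m] with [m + 2 l / n.+1 <= l]. For words of length [x] this is
    satisfied by a multiple of [x (x - 1) (x - 2)], and the gains then
    telescope, their sum being the same multiple of
    [(x + 1) x (x - 1) (x - 2) / 4]. In the statement [x] is [n + 1], and the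
    normalization by [2 L ^ 3] keeps the parameter below [1/2] up to length
    [L]. *)
Lemma singles_laplace (L n : nat) : (n < L)%N ->
  word_mean alpha n (fun w =>
    expR (- ((n%:R + 1) * n%:R * (n%:R - 1) / (2 * L%:R ^+ 3)
      * (singles w)%:R)))
  <= expR (- ((1 - alpha) / 2 *
      ((n%:R + 2) * (n%:R + 1) * n%:R * (n%:R - 1) / 4 / (2 * L%:R ^+ 3)))).
Proof.
have /andP[a0 a1] := alpha01.
elim: n => [|n IHn] nL.
  by rewrite /= !(mulr0, mul0r, oppr0).
have L0 : 0 < L%:R :> R by rewrite ltr0n (leq_trans _ nL).
have D0 : 0 < 2 * L%:R ^+ 3 :> R by rewrite mulr_gt0 // exprn_gt0.
have nL' : n%:R + 2 <= L%:R :> R by rewrite -natrD ler_nat addn2.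
have n0 : 0 <= n%:R :> R by [].
have nn : 0 <= n%:R * (n%:R - 1) :> R.
  by case: (n) => [|j]; rewrite ?mul0r // -natr1 addrK mulr_ge0.
have LD : (n%:R + 2) * (n%:R + 1) * n%:R <= L%:R ^+ 3 :> R.
  have : (n%:R + 2) ^+ 3 <= L%:R ^+ 3 :> R by rewrite lerXn2r ?nnegrE ?addr_ge0.
  by apply: le_trans; nra.
set D := 2 * L%:R ^+ 3 in D0 IHn *.
have nE : n.+1%:R = n%:R + 1 :> R by rewrite natr1.
pose l : R := (n%:R + 2) * (n%:R + 1) * n%:R / D.
pose m : R := (n%:R + 1) * n%:R * (n%:R - 1) / D.
have l0 : 0 <= l by rewrite divr_ge0 ?mulr_ge0 ?addr_ge0 // ltW.
have l2 : l <= 2^-1.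
  by rewrite /l ler_pdivrMr // /D mulrA mulVf // mul1r.
have ml : m + 2 * l / n.+1%:R <= l.
  rewrite nE -subr_ge0.
  have -> : l - (m + 2 * l / (n%:R + 1)) = n%:R * (n%:R - 1) / D.
    by rewrite /l /m; field; rewrite (gt_eqF D0) /= natr1 pnatr_eq0.
  exact: divr_ge0 (ltW D0).
apply: (@le_trans _ _ (word_mean alpha n (fun w =>
    expR (- ((1 - alpha) * l / 2)) * expR (- (m * (singles w)%:R))))).
  have -> : (n.+1%:R + 1) * n.+1%:R * (n.+1%:R - 1) / D = l.
    by rewrite nE addrK -addrA.
  rewrite [word_mean _ n.+1 _]/=; apply: word_mean_le => // w wn.
  exact: word_step.
rewrite word_meanZ //; apply: le_trans (ler_wpM2l (expR_ge0 _) (IHn (ltnW nL))) _.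
rewrite -expRD ler_expR nE le_eqVlt; apply/orP; left; apply/eqP.
by rewrite /l; field; rewrite gt_eqF.
Qed.

(** Chernoff bound: the Laplace parameter of the last word is at most [1/2],
    so the event that it has fewer than [2 k] single letters costs at most a
    factor [expR k]. *)
Lemma few_singles n k : (4 <= n)%N ->
  word_mean alpha n (fun w => (singles w < k.*2)%N%:R)
  <= expR (k%:R - (1 - alpha) * n.+1%:R / 32).
Proof.
move=> n4; have /andP[a0 a1] := alpha01.
have x4 : 4 <= n%:R :> R by rewrite ler_nat.
have nE : n.+1%:R = n%:R + 1 :> R by rewrite natr1.
have D0 : 0 < 2 * n.+1%:R ^+ 3 :> R by rewrite mulr_gt0 // exprn_gt0.
pose l : R := (n%:R + 1) * n%:R * (n%:R - 1) / (2 * n.+1%:R ^+ 3).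
have l2 : l <= 2^-1.
  rewrite /l ler_pdivrMr // mulrA mulVf // mul1r nE.
  by move: (n%:R) x4 => x x4; nra.
apply: (@le_trans _ _ (word_mean alpha n (fun w =>
    expR k%:R * expR (- (l * (singles w)%:R))))).
  apply: word_mean_le => // w _; rewrite -expRD.
  case: ltnP => /= [sk|_]; last exact: expR_ge0.
  apply: le_trans (expR_ge1Dx _); rewrite lerDl subr_ge0.
  have : (singles w)%:R <= 2 * k%:R :> R.
    by rewrite -natrM ler_nat mul2n ltnW.
  have : l * (singles w)%:R <= 2^-1 * (singles w)%:R by rewrite ler_wpM2r.
  by lra.
rewrite word_meanZ // expRD ler_pM2l ?expR_gt0 //.
apply: le_trans (singles_laplace (leqnn n.+1)) _.
rewrite ler_expR lerN2 nE.
have -> : (1 - alpha) * (n%:R + 1) / 32 =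
    (1 - alpha) / 2 * ((n%:R + 1) / 16) by field.
apply: ler_wpM2l; first by rewrite divr_ge0 // subr_ge0 ltW.
have x1 : 0 < n%:R + 1 :> R by rewrite natr1.
rewrite -subr_ge0; move: (n%:R) x4 x1 => x x4 x1.
have -> : (x + 2) * (x + 1) * x * (x - 1) / 4 / (2 * (x + 1) ^+ 3) - (x + 1) / 16 =
    (x ^+ 3 - x ^+ 2 - 7 * x - 1) / (16 * (x + 1) ^+ 2).
  by field; rewrite gt_eqF.
rewrite divr_ge0 ?mulr_ge0 ?(ltW x1) //.
have : 0 <= (x - 4) * x * x by rewrite !mulr_ge0 //; lra.
have : 0 <= (x - 4) * x by rewrite !mulr_ge0 //; lra.
by rewrite exprS expr2; lra.
Qed.

End Chernoff.

(** * The law of the product read along a fixed word *)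

Section WordLaw.
Context {R : realType} {gT : finGroupType} (mu : gT -> R).
Context (mu_pmf : is_pmf mu) (n : nat).
Implicit Types (y : {ffun 'I_n.+1 -> gT}) (w : seq nat).

Local Notation N := (#|gT|%:R : R).

Definition sample_prob y : R := \prod_i mu (y i).

Definition word_prod y w : gT := (\prod_(r <- w) y (inord r))%g.

Definition resampled y (i : 'I_n.+1) (g : gT) : {ffun 'I_n.+1 -> gT} :=
  [ffun j => if j == i then g else y j].

Lemma sample_prob_ge0 y : 0 <= sample_prob y.
Proof. by apply: prodr_ge0 => i _; exact: mu_pmf.1. Qed.

Lemma sum_sample_prob : \sum_y sample_prob y = 1.
Proof. by rewrite -(bigA_distr_bigA (fun _ => mu)) /= mu_pmf.2 big1. Qed.

Lemma sample_prob_resampled y i g :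
  sample_prob (resampled y i g) * mu (y i) = sample_prob y * mu g.
Proof.
rewrite /sample_prob (bigD1 i) //= [in RHS](bigD1 i) //= ffunE eqxx.
rewrite mulrC mulrA [RHS]mulrC mulrA [mu g * _]mulrC; congr (_ * _).
by apply: eq_bigr => j /negbTE ji; rewrite ffunE ji.
Qed.

(** Exchanging the coordinate [i] with an independent sample is a
    measure-preserving involution. *)
Lemma resample i (F : {ffun 'I_n.+1 -> gT} -> R) :
  \sum_y sample_prob y * F y =
  \sum_y sample_prob y * \sum_g mu g * F (resampled y i g).
Proof.
pose swap (q : {ffun 'I_n.+1 -> gT} * gT) := (resampled q.1 i q.2, q.1 i).
have swapK : involutive swap.
  case=> y g; rewrite /swap /= ffunE eqxx; congr pair.
  by apply/ffunP => j; rewrite !ffunE; case: eqP => [->|].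
transitivity (\sum_q sample_prob q.1 * mu q.2 * F q.1).
  rewrite -(pair_bigA _ (fun y g => sample_prob y * mu g * F y)) /=.
  apply: eq_bigr => y _; rewrite -mulr_suml -mulr_sumr mu_pmf.2 mulr1 //.
rewrite (reindex_inj (inv_inj swapK)) /=.
under [RHS]eq_bigr do rewrite mulr_sumr.
rewrite (pair_bigA _ (fun y g => sample_prob y * (mu g * F (resampled y i g)))) /=.
by apply: eq_bigr => -[y g] _ /=; rewrite sample_prob_resampled mulrA.
Qed.

Definition mixed_steps y (S : pred nat) w : seq (option gT) :=
  [seq if S r then None else Some (y (inord r)) | r <- w].

(** Samples of letters in [S], which occur at most once, may be integrated out
    one at a time, from the end of the word; the other samples are kept as
    prescribed steps. The target [x] depends on the samples because dividing
    by a prescribed last step turns a constant target into such a function. *)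
Lemma word_prod_walk (S : pred nat) w (x : {ffun 'I_n.+1 -> gT} -> gT) :
  all (fun r => r <= n)%N w ->
  (forall r, S r -> (count_mem r w <= 1)%N) ->
  (forall y r g, S r -> (r <= n)%N -> x (resampled y (inord r) g) = x y) ->
  \sum_y sample_prob y * (word_prod y w == x y)%:R =
  \sum_y sample_prob y * walk mu (point_mass 1%g) (mixed_steps y S w) (x y).
Proof.
elim/last_ind: w x => [|w r IHw] x wn wS xS.
  by apply: eq_bigr => y _; rewrite /word_prod big_nil eq_sym.
move: wn; rewrite all_rcons => /andP[rn wn].
have {}wS s : S s -> (count_mem s w + (r == s) <= 1)%N.
  by move=> /wS; rewrite -cats1 count_cat /= addn0.
have wS' s : S s -> (count_mem s w <= 1)%N.
  by move=> /wS; apply: leq_trans; rewrite leq_addr.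
have last_prod y : word_prod y (rcons w r) = (word_prod y w * y (inord r))%g.
  by rewrite /word_prod -cats1 big_cat big_seq1.
have inordE s : (s <= n)%N -> (inord s == inord r :> 'I_n.+1) = (s == r).
  by move=> sn; rewrite -val_eqE /= !inordK.
case: (boolP (S r)) => Sr; last first.
  rewrite (eq_bigr (fun y => sample_prob y *
      (word_prod y w == x y * (y (inord r))^-1)%g%:R)); last first.
    move=> y _; rewrite last_prod; congr (_ * (_ : bool)%:R).
    by rewrite -(inj_eq (mulIg (y (inord r))^-1%g)) mulgK.
  rewrite IHw //; last first.
    move=> y s g Ss sn; rewrite xS // ffunE eq_sym inordE //.
    by case: eqP => // sr; move: Sr; rewrite -sr Ss.
  apply: eq_bigr => y _; congr (_ * _).
  by rewrite /mixed_steps map_rcons walk_rcons (negbTE Sr).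
have rw : r \notin w.
  apply/count_memPn; have := wS _ Sr; rewrite eqxx addn1.
  by case: (count_mem r w).
rewrite (resample (inord r)).
transitivity (\sum_g mu g * \sum_y sample_prob y *
    (word_prod y w == x y * g^-1)%g%:R).
  under eq_bigr do rewrite mulr_sumr.
  rewrite exchange_big /=; apply: eq_bigr => g _; rewrite mulr_sumr.
  apply: eq_bigr => y _; rewrite mulrCA; congr (_ * (_ * (_ : bool)%:R)).
  rewrite xS // last_prod ffunE eqxx -(inj_eq (mulIg g^-1%g)) mulgK.
  congr (_ == _); rewrite /word_prod; apply: eq_big_seq => s sw.
  rewrite ffunE inordE ?(allP wn) //.
  by case: eqP => // sr; move: rw; rewrite -sr sw.
transitivity (\sum_g mu g * \sum_y sample_prob y *
    walk mu (point_mass 1%g) (mixed_steps y S w) (x y * g^-1)%g).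
  by apply: eq_bigr => g _; rewrite IHw // => y s h Ss sn; rewrite xS.
under eq_bigr do rewrite mulr_sumr.
rewrite exchange_big /=; apply: eq_bigr => y _.
rewrite /mixed_steps map_rcons walk_rcons Sr /= /convolve mulr_sumr.
by apply: eq_bigr => g _; rewrite mulrCA.
Qed.

Definition word_law w (x : gT) : R :=
  \sum_y sample_prob y * (word_prod y w == x)%:R.

Lemma word_law_ge0 w x : 0 <= word_law w x.
Proof. by apply: sumr_ge0 => y _; rewrite mulr_ge0 ?sample_prob_ge0. Qed.

Lemma word_law_le1 w x : word_law w x <= 1.
Proof.
rewrite -sum_sample_prob; apply: ler_sum => y _.
by rewrite ler_piMr ?sample_prob_ge0 // lern1 leq_b1.
Qed.

Lemma word_law_crude w x : `| N * word_law w x - 1 | <= N.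
Proof.
have N1 : 1 <= N by rewrite ler1n; apply/card_gt0P; exists 1%g.
have q0 := word_law_ge0 w x; have q1 := word_law_le1 w x.
rewrite ler_norml; apply/andP; split; nra.
Qed.

Lemma word_law_uniform (mu0 b : R) w (x : gT) (k : nat) :
  0 < mu0 -> mu0 <= mu 1%g -> (2 <= #|gT|)%N ->
  isoperimetric_profile mu 2^-1 != 0 -> 4 <= b ->
  (profile_tail mu b (4 / N) < (mu0 / 16 * k%:R)%:E)%E ->
  all (fun r => r <= n)%N w -> (k.*2 <= singles w)%N ->
  `| N * word_law w x - 1 | <= 4 / b.
Proof.
move=> mu0_gt0 mu0_le G1 Phi0 b4 tail wn ks.
have -> : word_law w x = \sum_y sample_prob y *
    walk mu (point_mass 1%g) (mixed_steps y (single w) w) x.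
  by apply: (@word_prod_walk _ _ (fun=> x)) => // r /eqP ->.
have -> : N * (\sum_y sample_prob y *
      walk mu (point_mass 1%g) (mixed_steps y (single w) w) x) - 1 =
    \sum_y sample_prob y *
      (N * walk mu (point_mass 1%g) (mixed_steps y (single w) w) x - 1).
  rewrite -[X in _ - X]sum_sample_prob mulr_sumr -sumrB.
  by apply: eq_bigr => y _; ring.
apply: le_trans (ler_norm_sum _ _ _) _.
have -> : 4 / b = \sum_y sample_prob y * (4 / b).
  by rewrite -mulr_suml sum_sample_prob mul1r.
apply: ler_sum => y _.
rewrite normrM ger0_norm ?sample_prob_ge0 //.
apply: ler_wpM2l; first exact: sample_prob_ge0.
apply: (@walk_uniform _ _ _ mu0 b _ _ k) => //.
apply: leq_trans ks _; rewrite count_map; apply: sub_count => r /=.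
by move=> ->.
Qed.

End WordLaw.

(** * From the probability space to words *)

Lemma measure_fin_partition {R : realType} {d : measure_display}
    {T : measurableType d} (P : probability T R) (I : finType)
    (E : set T) (F : I -> set T) :
  (forall i, measurable (F i)) ->
  (forall w, E w <-> exists i, F i w) ->
  (forall i j w, F i w -> F j w -> i = j) ->
  P E = (\sum_i P (F i))%E.
Proof.
move=> mF EF disj.
have -> : E = (\bigcup_(i in [set` index_enum I]) F i)%classic.
  apply/seteqP; split => w.
    by move/EF => [i Fi]; exists i => //=; exact: mem_index_enum.
  by move=> [i _ Fi]; apply/EF; exists i.
rewrite measure_fin_bigcup //.
  by rewrite -fsbig_seq //; exact: index_enum_uniq.
by move=> i j _ _ [w [Fi Fj]]; exact: disj Fi Fj.
Qed.

Section IntersectionCons.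
Context {T : Type} {I : choiceType}.
Implicit Types (A : I -> set T) (J : seq I).

Definition with_event A (i : I) (B : set T) : I -> set T :=
  fun j => if j == i then B else A j.

Lemma bigcap_with_event A J i B : i \notin J ->
  (\bigcap_(j in [set` i :: J]) with_event A i B j =
   B `&` \bigcap_(j in [set` J]) A j)%classic.
Proof.
move=> iJ; rewrite !bigcap_seq big_cons /with_event eqxx; congr (_ `&` _)%classic.
by apply: eq_big_seq => j jJ; case: eqP => // ji; move: iJ; rewrite -ji jJ.
Qed.

Lemma prode_with_event {R : realType} (p : set T -> \bar R) A J i B :
  i \notin J ->
  (\prod_(j <- i :: J) p (with_event A i B j) =
   p B * \prod_(j <- J) p (A j))%E.
Proof.
move=> iJ; rewrite big_cons /with_event eqxx; congr (_ * _)%E.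
by apply: eq_big_seq => j jJ; case: eqP => // ji; move: iJ; rewrite -ji jJ.
Qed.

End IntersectionCons.

Section RandomWord.
Context {R : realType} {gT : finGroupType} (mu : gT -> R) (alpha : R).
Context (alpha01 : 0 <= alpha < 1).
Context {d : measure_display} {T : measurableType d} (P : probability T R).
Context (xi : nat -> T -> bool) (u : nat -> T -> nat).
Context (Y X S : nat -> T -> gT).
Context (srrw : srrw_construction P mu alpha xi u Y X S).

(** The word of the walk at time [n.+1]; copied times start at 1 and positions
    in the word at 0, whence the predecessor. *)
Fixpoint random_word n (w : T) : seq nat :=
  if n is m.+1 then
    let s := random_word m w in
    rcons s (if xi m.+2 w then nth 0%N s (u m.+2 w).-1 else m.+1)
  else [:: 0%N].

Lemma random_wordP n w : is_word n (random_word n w).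
Proof.
elim: n => //= n IHn; case: (xi _ w); last exact: is_word_fresh.
apply: is_word_copy => //.
by have := srrw_u_range srrw w (isT : 2 <= n.+2)%N; case: (u _ w) => //= k.
Qed.

Lemma step_random_word n k w : (k <= n)%N ->
  X k.+1 w = Y (nth 0%N (random_word n w) k).+1 w.
Proof.
elim: n k => [|n IHn] k; first by rewrite leqn0 => /eqP ->; rewrite (srrw_X1 srrw).
have /andP[/eqP sw _] := random_wordP n w.
rewrite leq_eqVlt => /predU1P[->|kn]; last first.
  by rewrite IHn //= nth_rcons sw kn.
rewrite (srrw_XS srrw) //= nth_rcons sw ltnn eqxx.
have := srrw_u_range srrw w (isT : 2 <= n.+2)%N.
case: (xi n.+2 w) => //; by case: (u n.+2 w) => //= k' kn; rewrite IHn.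
Qed.

Lemma position_random_word n w :
  S n.+1 w = (\prod_(r <- random_word n w) Y r.+1 w)%g.
Proof.
elim: n => [|n IHn].
  by rewrite (srrw_SS srrw) //= (srrw_S0 srrw) mul1g big_seq1 (srrw_X1 srrw).
rewrite (srrw_SS srrw) // (step_random_word w (leqnn _)) IHn /=.
have /andP[/eqP sw _] := random_wordP n w.
by rewrite nth_rcons sw ltnn eqxx -cats1 big_cat big_seq1.
Qed.

Definition word_event n (W : pred (seq nat)) : set T :=
  [set w | W (random_word n w)]%classic.

Definition fresh_pred n (W : pred (seq nat)) : pred (seq nat) :=
  fun s => W (rcons s n.+1).

Definition copy_pred k (W : pred (seq nat)) : pred (seq nat) :=
  fun s => W (rcons s (nth 0%N s k)).

Lemma word_eventS n W w : word_event n.+1 W w <->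
  if xi n.+2 w then word_event n (copy_pred (u n.+2 w).-1 W) w
  else word_event n (fresh_pred n W) w.
Proof.
by rewrite /word_event /copy_pred /fresh_pred /=; case: (xi n.+2 w).
Qed.

Local Notation source := (nat + (nat + nat))%type.

Lemma source_measurable (i : source) A : srrw_sources xi u Y i A -> measurable A.
Proof.
by case: i => [n|[n|n]] [B _ <-];
  [apply: (srrw_xi_rv srrw) | apply: (srrw_u_rv srrw) | apply: (srrw_Y_rv srrw)].
Qed.

Lemma sources_measurable (J : seq source) (A : source -> set T) :
  (forall i, i \in J -> srrw_sources xi u Y i (A i)) ->
  measurable (\bigcap_(i in [set` J]) A i)%classic.
Proof.
move=> JA; rewrite bigcap_seq big_seq; apply: (big_ind measurable) => //.
  exact: measurableI.
by move=> i /JA; exact: source_measurable.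
Qed.

Lemma word_event_measurable n W : measurable (word_event n W).
Proof.
elim: n W => [|n IHn] W.
  have [W0|W0] := boolP (W [:: 0%N]).
    by rewrite (_ : word_event 0 W = setT) //; apply/seteqP; split.
  rewrite (_ : word_event 0 W = set0) //; apply/seteqP; split => // w.
  by rewrite /word_event /= (negbTE W0).
have mxi b : measurable (xi n.+2 @^-1` [set b])%classic.
  exact: (srrw_xi_rv srrw).
have mu_ k : measurable (u n.+2 @^-1` [set k])%classic.
  exact: (srrw_u_rv srrw).
rewrite (_ : word_event n.+1 W =
  ((xi n.+2 @^-1` [set false]) `&` word_event n (fresh_pred n W)) `|`
  (\bigcup_k ((xi n.+2 @^-1` [set true]) `&` (u n.+2 @^-1` [set k])
     `&` word_event n (copy_pred k.-1 W))))%classic.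
  apply: measurableU; first exact: measurableI.
  by apply: bigcup_measurable => k _; apply: measurableI => //; exact: measurableI.
apply/seteqP; split => w.
  move/word_eventS; case E : (xi n.+2 w) => H; last by left.
  by right; exists (u n.+2 w).
case=> [[E H]|[k _ [[E uk] H]]]; apply/word_eventS; rewrite E //.
by rewrite uk.
Qed.

Lemma copied_law n : P (xi n.+2 @^-1` [set true])%classic = alpha%:E.
Proof. exact: (srrw_xi_law srrw). Qed.

Lemma fresh_law n : P (xi n.+2 @^-1` [set false])%classic = (1 - alpha)%:E.
Proof.
rewrite (_ : (_ @^-1` _)%classic = (~` (xi n.+2 @^-1` [set true]))%classic).
  by rewrite probability_setC ?copied_law //; exact: (srrw_xi_rv srrw).
by apply/seteqP; split => w /=; case: (xi n.+2 w).
Qed.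

(** By induction on [n], splitting according to whether the new step is fresh
    and, if not, according to the copied time. The family [J] of further
    independent events is what carries the induction: the variables of time
    [n.+2] join it and the word of time [n.+1] is handled by the induction
    hypothesis. *)
Lemma word_event_law n W (J : seq source) (A : source -> set T) :
  uniq J -> (forall i, i \in J -> srrw_sources xi u Y i (A i)) ->
  (forall m, (m < n)%N -> (inl m \notin J) && (inr (inl m) \notin J)) ->
  (P (word_event n W `&` \bigcap_(i in [set` J]) A i)%classic =
   (word_mean alpha n (fun s => (W s)%:R))%:E * \prod_(i <- J) P (A i))%E.
Proof.
elim: n W J A => [|n IHn] W J A uJ JA nJ /=.
  rewrite -(srrw_indep srrw uJ JA); have [W0|W0] := boolP (W [:: 0%N]).
    rewrite mul1e; congr (P _); apply/seteqP; split => w; first by case.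
    by move=> Aw; split.
  rewrite mul0e (_ : (_ `&` _)%classic = set0) ?measure0 //.
  by apply/seteqP; split => // w []; rewrite /word_event /= (negbTE W0).
have /andP[xiJ uJn] := nJ n (ltnSn n).
pose Jx := inl n :: J; pose Jxu := inr (inl n) :: Jx.
pose Ax b := with_event A (inl n) (xi n.+2 @^-1` [set b])%classic.
pose Axu k := with_event (Ax true) (inr (inl n)) (u n.+2 @^-1` [set k])%classic.
have uJx : inr (inl n) \notin Jx by rewrite inE negb_or uJn.
have JxA b i : i \in Jx -> srrw_sources xi u Y i (Ax b i).
  rewrite inE /Ax /with_event; case: eqP => [->|] _ /=; last exact: JA.
  by exists [set b]%classic.
have JxuA k i : i \in Jxu -> srrw_sources xi u Y i (Axu k i).
  rewrite inE /Axu /with_event; case: eqP => [->|] _ /=; last exact: JxA.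
  by exists [set k]%classic.
have nJx m : (m < n)%N -> (inl m \notin Jx) && (inr (inl m) \notin Jx).
  move=> mn; have /andP[H1 H2] := nJ m (ltnW mn).
  rewrite !inE !negb_or H1 H2 /= andbT.
  by rewrite neq_ltn mn.
have nJxu m : (m < n)%N -> (inl m \notin Jxu) && (inr (inl m) \notin Jxu).
  move=> mn; have /andP[H1 H2] := nJ m (ltnW mn).
  by rewrite !inE !negb_or H1 H2 /= !andbT !neq_ltn mn.
have uniqx : uniq Jx by rewrite /= xiJ.
have uniqxu : uniq Jxu by rewrite cons_uniq uJx.
pose F (i : option 'I_n.+1) : set T :=
  (if i is Some k then
     word_event n (copy_pred k W) `&` \bigcap_(i in [set` Jxu]) Axu k.+1 i
   else word_event n (fresh_pred n W) `&` \bigcap_(i in [set` Jx]) Ax false i)%classic.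
have FN : F None = (word_event n (fresh_pred n W) `&`
    (xi n.+2 @^-1` [set false] `&` \bigcap_(i in [set` J]) A i))%classic.
  by rewrite /F bigcap_with_event.
have FS k : F (Some k) = (word_event n (copy_pred k W) `&`
    (u n.+2 @^-1` [set k.+1] `&`
      (xi n.+2 @^-1` [set true] `&` \bigcap_(i in [set` J]) A i)))%classic.
  by rewrite /F bigcap_with_event // bigcap_with_event.
have mF i : measurable (F i).
  case: i => [k|]; apply: measurableI; try exact: word_event_measurable.
    exact: sources_measurable (JxuA k.+1).
  exact: sources_measurable (JxA false).
rewrite (@measure_fin_partition _ _ _ P _ _ F mF); last first.
- move=> [k|] [k'|] w; rewrite ?FN ?FS //=.
  + move=> [_ [uk _]] [_ [uk' _]]; congr Some; apply/val_inj => /=.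
    by apply: succn_inj; rewrite -uk -uk'.
  + by move=> [_ [_ [xt _]]] [_ [xf _]]; move: xt; rewrite /= xf.
  + by move=> [_ [xf _]] [_ [_ [xt _]]]; move: xt; rewrite /= xf.
- move=> w; split.
    move=> [/word_eventS]; case E : (xi n.+2 w) => HW HA.
      have ur := srrw_u_range srrw w (isT : 2 <= n.+2)%N.
      have un : ((u n.+2 w).-1 < n.+1)%N by move: ur; case: (u _ w) => //= k.
      exists (Some (Ordinal un)); rewrite FS; split => //; split => //=.
      by move: ur; case: (u _ w).
    by exists None; rewrite FN; split.
  move=> [[k|]]; rewrite ?FN ?FS.
    move=> [HW [uk [xt HA]]]; split => //; apply/word_eventS.
    by rewrite xt uk.
  by move=> [HW [xf HA]]; split => //; apply/word_eventS; rewrite xf.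
have [q qE] : exists q : R, (\prod_(i <- J) P (A i))%E = q%:E.
  exists (fine (P (\bigcap_(i in [set` J]) A i)%classic)).
  rewrite fineK ?fin_num_measure //; last exact: sources_measurable.
  by rewrite (srrw_indep srrw).
have PN : P (F None) = (word_mean alpha n (fun s => (fresh_pred n W s)%:R)
    * ((1 - alpha) * q))%:E.
  rewrite /F (IHn _ _ _ uniqx (JxA false) nJx).
  by rewrite prode_with_event // fresh_law qE -!EFinM.
have PS k : P (F (Some k)) = (word_mean alpha n (fun s => (copy_pred k W s)%:R)
    * (n.+1%:R^-1 * (alpha * q)))%:E.
  rewrite /F (IHn _ _ _ uniqxu (JxuA k.+1) nJxu).
  rewrite prode_with_event // prode_with_event // copied_law qE.
  have -> : P (u n.+2 @^-1` [set k.+1])%classic = (n.+1%:R^-1)%:E.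
    by apply: (srrw_u_law srrw) => //=; exact: ltn_ord.
  by rewrite -!EFinM.
rewrite (bigD1 None) //= (reindex_onto Some (fun i => odflt ord0 i)) /=; last first.
  by case.
rewrite PN qE; under eq_bigr do rewrite PS.
rewrite big_mkcond /=; under eq_bigr do rewrite eqxx /=.
rewrite sumEFin -EFinD -EFinM; congr EFin.
rewrite word_meanD // word_meanZ // word_mean_sum //.
rewrite [RHS]mulrDl mulr_suml; congr (_ + _); first by rewrite mulrCA mulrA.
apply: eq_bigr => k _; rewrite word_meanZ //.
by rewrite mulrCA [n.+1%:R^-1 * _]mulrA [n.+1%:R^-1 * _]mulrC; ring.
Qed.

(** The samples are fixed first, as one more family of independent events; the
    position is then a function of the word. *)
Lemma position_law n x :
  P (S n.+1 @^-1` [set x])%classic =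
  (word_mean alpha n (fun s => word_law mu n s x))%:E.
Proof.
pose J : seq source := [seq inr (inr i) | i <- iota 0 n.+1].
pose A (y : {ffun 'I_n.+1 -> gT}) (i : source) : set T :=
  if i is inr (inr j) then (Y j.+1 @^-1` [set y (inord j)])%classic else setT.
have uJ : uniq J by rewrite map_inj_uniq ?iota_uniq // => i j [].
have JA y i : i \in J -> srrw_sources xi u Y i (A y i).
  by move=> /mapP[j _ ->]; exists [set y (inord j)]%classic.
have nJ m : (m < n)%N -> (inl m \notin J) && (inr (inl m) \notin J).
  by move=> _; apply/andP; split; apply/negP => /mapP[].
pose F (y : {ffun 'I_n.+1 -> gT}) : set T :=
  (word_event n (fun s => word_prod y s == x) `&` \bigcap_(i in [set` J]) A y i)%classic.
have AP y w : (\bigcap_(i in [set` J]) A y i)%classic w <->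
    forall j : 'I_n.+1, Y j.+1 w = y j.
  split=> [H j|H i /= /mapP[j]].
    have := H (inr (inr (j : nat))); rewrite /A /= inord_val; apply.
    by rewrite mem_map ?mem_iota ?ltn_ord // => a b [].
  rewrite mem_iota add0n => /andP[_ jn] ->.
  by rewrite /A /= -(H (inord j)) inordK.
have SP (y : {ffun 'I_n.+1 -> gT}) w : (forall j : 'I_n.+1, Y j.+1 w = y j) ->
    S n.+1 w = word_prod y (random_word n w).
  move=> H; rewrite position_random_word /word_prod; apply: eq_big_seq => r rw.
  have /andP[_ /allP/(_ _ rw) rn] := random_wordP n w.
  by rewrite -(H (inord r)) inordK.
rewrite (@measure_fin_partition _ _ _ P _ _ F); first last.
- move=> y y' w [_ /AP Hy] [_ /AP Hy'].
  by apply/ffunP => j; rewrite -Hy -Hy'.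
- move=> w; split.
    move=> Sx; exists [ffun j : 'I_n.+1 => Y j.+1 w].
    have H (j : 'I_n.+1) : Y j.+1 w = [ffun j : 'I_n.+1 => Y j.+1 w] j by rewrite ffunE.
    split; last exact/AP.
    by rewrite /word_event /= -SP //; apply/eqP.
  by move=> [y [Wy /AP /SP Sy]]; rewrite /= Sy; apply/eqP.
- move=> y; apply: measurableI; first exact: word_event_measurable.
  exact: sources_measurable (JA y).
have PF y : P (F y) = (word_mean alpha n
    (fun s => sample_prob mu y * (word_prod y s == x)%:R))%:E.
  rewrite /F (word_event_law _ uJ (JA y) nJ) word_meanZ // mulrC EFinM.
  congr (_ * _)%E; rewrite big_map /sample_prob -[iota 0 n.+1]/(index_iota 0 n.+1).
  rewrite big_mkord -prodEFin; apply: eq_bigr => j _.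
  by rewrite /A /= inord_val (srrw_Y_law srrw).
under eq_bigr do rewrite PF.
by rewrite sumEFin -word_mean_sum.
Qed.

End RandomWord.

(** * Mixing time *)

Section Position.
Context {R : realType} {gT : finGroupType} (mu : gT -> R) (alpha : R).
Context (mu_pmf : is_pmf mu) (alpha01 : 0 <= alpha < 1).
Context {d : measure_display} {T : measurableType d} (P : probability T R).
Context (S : nat -> T -> gT) (srrw : is_SRRW P mu alpha S).

Local Notation N := (#|gT|%:R : R).

(** Words with at least [2 k] single letters give mass functions uniformly
    close to uniform; the others are rare, and for them the trivial bound [N]
    is used. *)
Lemma d_infty_le (mu0 b : R) (n k : nat) :
  0 < mu0 -> mu0 <= mu 1%g -> (2 <= #|gT|)%N ->
  isoperimetric_profile mu 2^-1 != 0 -> 4 <= b ->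
  (profile_tail mu b (4 / N) < (mu0 / 16 * k%:R)%:E)%E -> (4 <= n)%N ->
  d_infty P S n.+1 <= 4 / b + N * expR (k%:R - (1 - alpha) * n.+1%:R / 32).
Proof.
move=> mu0_gt0 mu0_le G1 Phi0 b4 tail n4.
case: srrw => xi [u [Y [X constr]]].
pose bad (s : seq nat) : R := 4 / b + N * (singles s < k.*2)%N%:R.
have b0 : 0 <= 4 / b by rewrite divr_ge0 // (le_trans _ b4).
have bad_le : word_mean alpha n bad <=
    4 / b + N * expR (k%:R - (1 - alpha) * n.+1%:R / 32).
  rewrite word_meanD // word_mean_cst // word_meanZ //.
  by rewrite lerD2l ler_wpM2l // few_singles.
apply: bigmax_le => [|x _].
  by rewrite addr_ge0 // mulr_ge0 // expR_ge0.
rewrite (position_law alpha01 constr) //= -word_meanZ //.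
have -> : word_mean alpha n (fun s => N * word_law mu n s x) - 1 =
    word_mean alpha n (fun s => N * word_law mu n s x - 1).
  by rewrite word_meanD // word_mean_cst.
have pointwise s : is_word n s -> `|N * word_law mu n s x - 1| <= bad s.
  case/andP => _ sn; rewrite /bad; case: ltnP => [_|ks]; rewrite ?mulr1 ?mulr0.
    by apply: le_trans (word_law_crude mu_pmf _ _ _) _; rewrite lerDr.
  by rewrite addr0; exact: (@word_law_uniform _ _ mu mu_pmf n mu0 b s x k).
rewrite ler_norml; apply/andP; split.
  rewrite lerNl; apply: le_trans bad_le; rewrite -[leLHS]mulN1r -word_meanZ //.
  apply: word_mean_le => // s /pointwise.
  by rewrite mulN1r ler_norml lerNl => /andP[].
apply: le_trans bad_le; apply: word_mean_le => // s /pointwise.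
by rewrite ler_norml => /andP[].
Qed.

End Position.

Lemma dyadic_bounds {R : realType} (t : R) : 1 <= t ->
  exists j, 2 ^+ j <= t /\ t < 2 ^+ j.+1.
Proof.
move=> t1; have t0 : 0 <= t by exact: le_trans t1.
have /andP[mt tm] := truncn_itv t0.
have m0 : (0 < Num.truncn t)%N by rewrite truncn_gt0.
have /andP[jl ju] := trunc_log_bounds (isT : 1 < 2)%N m0.
exists (trunc_log 2 (Num.truncn t)); split.
  by apply: le_trans mt; rewrite -natrX ler_nat.
by apply: lt_le_trans tm _; rewrite -natrX ler_nat.
Qed.

Lemma exprn2_le_expR {R : realType} j : 2 ^+ j <= expR (j%:R : R).
Proof.
rewrite -[j%:R]mulr1 expRM_natl lerXn2r ?nnegrE ?expR_ge0 //.
by apply: le_trans (expR_ge1Dx 1); lra.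
Qed.

Theorem proposition1p9 (R : realType) (mu0 : R) (hmu0 : 0 < mu0 <= 2^-1) :
  exists C : R, 0 < C /\
    forall (gT : finGroupType) (hG : (2 <= #|gT|)%N)
           (mu : gT -> R) (hmu : is_pmf mu) (hmu1 : mu0 <= mu 1%g)
           (alpha : R) (halpha : 0 <= alpha < 1)
           (d : measure_display) (T : measurableType d) (P : probability T R)
           (S : nat -> T -> gT) (hS : is_SRRW P mu alpha S)
           (eps : R) (heps : 0 < eps < 1),
      (uniform_mixing_time P S eps <=
         (C / (1 - alpha))%:E
         * profile_integral mu (4 / #|gT|%:R) (8 / eps))%E.
Proof.
have /andP[mu0_gt0 _] := hmu0.
pose c : R := 16 / mu0.
have c0 : 0 < c by rewrite divr_gt0.
(* With I the integral, k = c I + 1 fresh steps per half of the word are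
   enough, and the rare words need (1 - alpha) n / 32 >= k + ln (2 N / eps),
   where the logarithm is at most 2 I + 1 and I >= 1. The last summand of C
   absorbs the rounding of the number of steps to an integer. *)
pose C : R := 32 * (c + 4) + 1.
have C0 : 0 < C by rewrite /C; lra.
exists C; split => // gT hG mu hmu hmu1 alpha halpha d T P S hS eps heps.
have /andP[a0 a1] := halpha; have /andP[e0 e1] := heps.
have a1' : 0 < 1 - alpha by rewrite subr_gt0.
rewrite /profile_integral; case: eqVneq => [_|Phi0].
  by rewrite gt0_muley ?leey // lte_fin divr_gt0.
set N : R := #|gT|%:R; set b := 8 / eps.
rewrite -/(profile_integrand mu) -[X in (_ * X)%E]/(profile_tail mu b (4 / N)).
have N2 : 2 <= N by rewrite ler_nat.
have N0 : 0 < N by lra.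
have N1 : N^-1 <= 4 / N by rewrite ler_pMl ?invr_gt0 //; lra.
(* b is chosen so that the chi-square threshold 4 / b is half of eps *)
have b8 : 8 <= b by rewrite /b ler_pdivlMr //; nra.
have eE : 4 / b = eps / 2 by rewrite /b; field; rewrite gt_eqF.
have tail0 := @profile_tail_ge0 _ _ mu b _ N1.
have doubling j := @profile_tail_doubling _ _ _ hmu hG Phi0 b (4 / N) j N1.
have unif n k := @d_infty_le _ _ _ _ hmu halpha _ _ _ _ hS mu0 b n k
  mu0_gt0 hmu1 hG Phi0.
move: tail0 doubling unif; rewrite -/N.
case: (profile_tail mu b (4 / N)) => [r||] //; last first.
  by move=> _ _ _; rewrite gt0_muley ?leey // lte_fin divr_gt0.
move=> _ doubling unif.
(* j is the binary logarithm of 2 N / eps, rounded down *)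
have t4 : 4 < 2 * N / eps by rewrite ltr_pdivlMr //; nra.
have [j [jl ju]] := dyadic_bounds (ltW (lt_trans (ltr_nat R 1 4) t4)).
have jr : j%:R / 2 <= r.
  rewrite -lee_fin; apply: doubling.
  rewrite mulrAC ler_pdivrMr // /b.
  by move: jl; rewrite !ler_pdivlMr // mulrAC ler_pdivlMr //; lra.
have j2 : 2 <= j%:R :> R.
  rewrite ler_nat leqNgt; apply/negP => j1.
  have : (2 : R) ^+ j.+1 <= 2 ^+ 2 by rewrite ler_weXn2l ?ler1n.
  by have := lt_trans t4 ju; rewrite -natrX; lra.
have r1 : 1 <= r by lra.
pose k := (Num.truncn (c * r)).+1.
have cr0 : 0 <= c * r by rewrite mulr_ge0 ?ltW //; lra.
have /andP[kl ku] := truncn_itv cr0.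
have rk : (r%:E < (mu0 / 16 * k%:R)%:E)%E.
  rewrite lte_fin mulrAC ltr_pdivlMr //.
  move: ku; rewrite -/k /c mulrAC ltr_pdivrMr // mulrC [X in _ < X]mulrC.
  by [].
have kr : k%:R <= c * r + 1 by rewrite /k -natr1; lra.
pose n0 := Num.truncn (C / (1 - alpha) * r).
have n00 : 0 <= C / (1 - alpha) * r by rewrite mulr_ge0 ?divr_ge0 //; lra.
have /andP[nl nu] := truncn_itv n00.
apply: ge_ereal_inf; exists n0%:R%:E; last by rewrite -EFinM lee_fin.
exists n0 => //; split.
  rewrite truncn_gt0; apply: mulr_ege1 => //.
  by rewrite ler_pdivlMr //; rewrite /C; lra.
move=> m n0m.
have mbig : 32 * (c + 4) * r <= (1 - alpha) * m%:R.
  have mn : C / (1 - alpha) * r < m%:R + 1.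
    by apply: lt_le_trans nu _; rewrite natr1 ler_nat ltnS.
  have : C * r < (1 - alpha) * (m%:R + 1).
    by move: mn; rewrite mulrAC ltr_pdivrMr // [ltRHS]mulrC.
  by rewrite /C; nra.
have m5 : (5 <= m)%N.
  have : 5 <= m%:R :> R by nra.
  by rewrite ler_nat.
case: m m5 n0m mbig => // n n4 _ mbig.
apply: le_trans (unif n k _ rk n4) _; first by lra.
rewrite eE [leRHS](_ : eps = eps / 2 + eps / 2); last by field.
rewrite lerD2l.
have expo : k%:R - (1 - alpha) * n.+1%:R / 32 <= - (j.+1%:R).
  by rewrite -natr1; lra.
have : expR (k%:R - (1 - alpha) * n.+1%:R / 32) <= (2 ^+ j.+1)^-1.
  apply: le_trans (_ : expR (- (j.+1%:R)) <= _); first by rewrite ler_expR.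
  rewrite expRN lef_pV2 ?posrE ?expR_gt0 ?exprn_gt0 //.
  exact: exprn2_le_expR.
move=> /(ler_wpM2l (ltW N0)) /le_trans; apply.
have : (2 ^+ j.+1)^-1 <= (2 * N / eps)^-1.
  by rewrite lef_pV2 ?posrE ?exprn_gt0 ?divr_gt0 ?mulr_gt0 // ltW.
move=> /(ler_wpM2l (ltW N0)) /le_trans; apply.
rewrite le_eqVlt; apply/orP; left; apply/eqP.
by field; rewrite !gt_eqF.
Qed.
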